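(* Let $A$ be a complete Boolean algebra and let $\mathbf{V}^{A}$ be the Boolean-valued model over $A$ with its standard interpretation $\|\cdot\|$, in which $\neg$ is interpreted as the Boolean complement and $\bot$ as $0$. Then all set-theoretic axioms of $ZF_{C_\omega}$ and of $ZF_{C^2_\omega}$ (in both cases: Extensionality, Pairing, Collection, Powerset, Separation, Empty set, Union, Infinity, Regularity) are valid in $\mathbf{V}^{A}$.
   Context: Fix a model $\mathbf{V}$ of set theory. By transfinite recursion, $\mathbf{V}_\xi^{A}=\{x: x\text{ is a function},\ \mathrm{ran}(x)\subseteq A,\ \mathrm{dom}(x)\subseteq\mathbf{V}_\zeta^{A}\text{ for some }\zeta<\xi\}$, and $\mathbf{V}^{A}$ is the class of all $x$ belonging to some $\mathbf{V}_\xi^{A}$. The language is first-order with connectives $\to,\wedge,\vee,\neg,\bot$, quantifiers, binary predicates $\in,\approx$, and a constant for each element of $\mathbf{V}^{A}$; $\alpha\leftrightarrow\beta$ is $(\alpha\to\beta)\wedge(\beta\to\alpha)$, $\exists x\in u\,\varphi$ is $\exists x(x\in u\wedge\varphi)$, $\forall x\in u\,\varphi$ is $\forall x(x\in u\to\varphi)$. The standard interpretation is given by: $\|\bot\|=0$; $\|u\in v\|=\bigvee_{x\in\mathrm{dom}(v)}(v(x)\wedge\|x\approx u\|)$; $\|u\approx v\|=\bigwedge_{x\in\mathrm{dom}(u)}(u(x)\to\|x\in v\|)\wedge\bigwedge_{x\in\mathrm{dom}(v)}(v(x)\to\|x\in u\|)$; $\|\varphi\#\psi\|=\|\varphi\|\#\|\psi\|$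 for $\#\in\{\wedge,\vee,\to\}$; $\|\neg\varphi\|$ is the Boolean complement of $\|\varphi\|$; $\|\exists x\varphi\|=\bigvee_{u\in\mathbf{V}^{A}}\|\varphi(u)\|$; $\|\forall x\varphi\|=\bigwedge_{u\in\mathbf{V}^{A}}\|\varphi(u)\|$. A sentence $\varphi$ is valid in $\mathbf{V}^{A}$ if $\|\varphi\|=1$. The set-theoretic axioms, the same for both theories (schemas range over all formulas $\phi$ of the language, possibly containing $\neg$), are: Extensionality: $\forall x\forall y[\forall z(z\in x\leftrightarrow z\in y)\to x\approx y]$. Pairing: $\forall x\forall y\exists w\forall z[z\in w\leftrightarrow(z\approx x\vee z\approx y)]$. Collection: $\forall x[(\forall y\in x\,\exists z\,\phi(y,z))\to\exists w\,\forall y\in x\,\exists z\in w\,\phi(y,z)]$, $w$ not free in $\phi$. Powerset: $\forall x\exists w\forall z[z\in w\leftrightarrow\forall y\in z(y\in x)]$. Separation: $\forall x\exists w\forall z[z\in w\leftrightarrow(z\in x\wedge\phi(z))]$, $w$ not free in $\phi$. Empty set: $\exists x\forall z[z\in x\leftrightarrow((z\approx z)\to\bot)]$ (the unique such set is denoted $\emptyset$). Union: $\forall x\exists w\forall z[z\in w\leftrightarrow\exists y\in x(z\in y)]$. Infinity: $\exists x[\emptyset\in x\wedge\forall y\in x(y^+\in x)]$, where $y^+=y\cup\{y\}$. Regularity (Induction): $\forall x[(\forall y\in x\,\phi(y))\to\phi(x)]\to\forall x\,\phi(x)$, $y$ not free in $\phi(x)$. *)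

(* Defs.v *)
From mathcomp Require Import all_boot all_order.
From mathcomp Require Import boolp classical_sets.

Set Implicit Arguments.
Unset Strict Implicit.
Unset Printing Implicit Defensive.

Import Order.Def Order.Theory.
Local Open Scope classical_set_scope.
Local Open Scope order_scope.

Declare Scope zf_scope.
Delimit Scope zf_scope with zf.

(** * The language

  Bound variables are de Bruijn indices; [C] is the type of constants. *)

Inductive term (C : Type) : Type :=
  | Var of nat
  | Cst of C.
Arguments Var {C}.
Arguments Cst {C}.

Inductive formula (C : Type) : Type :=
  | FBot
  | FIn of term C & term C
  | FEq of term C & term C
  | FImp of formula C & formula C
  | FAnd of formula C & formula C
  | FOr of formula C & formula C
  | FNot of formula C
  | FEx of formula C
  | FAll of formula C.
Arguments FBot {C}.

Definition rename_term C (f : nat -> nat) (t : term C) : term C :=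
  if t is Var n then Var (f n) else t.

Definition up_ren (f : nat -> nat) (n : nat) : nat :=
  if n is m.+1 then (f m).+1 else 0.

Fixpoint rename C (f : nat -> nat) (p : formula C) : formula C :=
  match p with
  | FBot => FBot
  | FIn t s => FIn (rename_term f t) (rename_term f s)
  | FEq t s => FEq (rename_term f t) (rename_term f s)
  | FImp p q => FImp (rename f p) (rename f q)
  | FAnd p q => FAnd (rename f p) (rename f q)
  | FOr p q => FOr (rename f p) (rename f q)
  | FNot p => FNot (rename f p)
  | FEx p => FEx (rename (up_ren f) p)
  | FAll p => FAll (rename (up_ren f) p)
  end.

(** [skip k] makes room for a fresh variable of index [k]: in
  [rename (skip k) p] the variable [k] does not occur free. *)
Definition skip (k n : nat) : nat := if (n < k)%N then n else n.+1.

Notation "x ∈ y" := (FIn x y) (at level 70) : zf_scope.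
Notation "x ≈ y" := (FEq x y) (at level 70) : zf_scope.
Notation "p ⊃ q" := (FImp p q) (at level 99, right associativity) : zf_scope.
Notation "p ∧ q" := (FAnd p q) (at level 80, right associativity) : zf_scope.
Notation "p ∨ q" := (FOr p q) (at level 85, right associativity) : zf_scope.
Notation "# n" := (Var n) (at level 1, format "# n") : zf_scope.
Local Open Scope zf_scope.

Definition FIff C (p q : formula C) : formula C := (p ⊃ q) ∧ (q ⊃ p).
Notation "p ⇔ q" := (FIff p q) (at level 95) : zf_scope.

(** [∃x∈u p] and [∀x∈u p]: [u] lives outside of the binder, [p] inside. *)
Definition FExIn C (u : term C) (p : formula C) : formula C :=
  FEx (#0 ∈ rename_term succn u ∧ p).
Definition FAllIn C (u : term C) (p : formula C) : formula C :=
  FAll (#0 ∈ rename_term succn u ⊃ p).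

(** * The set-theoretic axioms

  In the comments the bound variables of each matrix are listed from index 0
  on.  Further free variables of a schema's formula act as parameters. *)

(* in context (x, ...): x is the empty set *)
Definition empty_formula C : formula C := FAll (#0 ∈ #1 ⇔ (#0 ≈ #0 ⊃ FBot)).

(* in context (s, y, ...): s = y ∪ {y} *)
Definition succ_formula C : formula C := FAll (#0 ∈ #1 ⇔ (#0 ∈ #2 ∨ #0 ≈ #2)).

(* matrix: z, y, x *)
Definition ax_extensionality C : formula C :=
  FAll (FAll (FAll (#0 ∈ #2 ⇔ #0 ∈ #1) ⊃ #1 ≈ #0)).

(* matrix: z, w, y, x *)
Definition ax_pairing C : formula C :=
  FAll (FAll (FEx (FAll (#0 ∈ #1 ⇔ (#0 ≈ #3 ∨ #0 ≈ #2))))).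

(* [p] is in context (z, y, x, ...); its second occurrence is in context
   (z, y, w, x, ...), with w not free *)
Definition ax_collection C (p : formula C) : formula C :=
  FAll (FAllIn #0 (FEx p) ⊃ FEx (FAllIn #1 (FExIn #1 (rename (skip 2) p)))).

(* matrix: z, w, x *)
Definition ax_powerset C : formula C :=
  FAll (FEx (FAll (#0 ∈ #1 ⇔ FAllIn #0 (#0 ∈ #3)))).

(* [p] is in context (z, x, ...); it occurs in context (z, w, x, ...), with w
   not free *)
Definition ax_separation C (p : formula C) : formula C :=
  FAll (FEx (FAll (#0 ∈ #1 ⇔ (#0 ∈ #2 ∧ rename (skip 1) p)))).

Definition ax_empty C : formula C := FEx (empty_formula C).

(* matrix: z, w, x *)
Definition ax_union C : formula C :=
  FAll (FEx (FAll (#0 ∈ #1 ⇔ FExIn #2 (#1 ∈ #0)))).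

(* the defined terms are eliminated in the usual way: "t ∈ x" for a set t
   defined by d(t) reads "∃t (d(t) ∧ t ∈ x)" *)
Definition ax_infinity C : formula C :=
  FEx (FEx (empty_formula C ∧ #0 ∈ #1) ∧
       FAllIn #0 (FEx (succ_formula C ∧ #0 ∈ #2))).

(* [p] is in context (x, ...); [p(y)] is [p] in context (y, x, ...), with x
   not free *)
Definition ax_induction C (p : formula C) : formula C :=
  (FAll (FAllIn #0 (rename (skip 1) p) ⊃ p) ⊃ FAll p).

Inductive set_axiom (C : Type) : formula C -> Prop :=
  | Extensionality : set_axiom (ax_extensionality C)
  | Pairing : set_axiom (ax_pairing C)
  | Collection p : set_axiom (ax_collection p)
  | Powerset : set_axiom (ax_powerset C)
  | Separation p : set_axiom (ax_separation p)
  | EmptySet : set_axiom (ax_empty C)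
  | Union : set_axiom (ax_union C)
  | Infinity : set_axiom (ax_infinity C)
  | Regularity p : set_axiom (ax_induction p).

(** The two theories have the same set-theoretic axioms and differ only in the
  underlying paraconsistent logic. *)
Definition ZF_Comega_axiom C : formula C -> Prop := @set_axiom C.
Definition ZF_C2omega_axiom C : formula C -> Prop := @set_axiom C.

Local Close Scope zf_scope.

(** * Models of set theory

  A model of set theory is an arbitrary first-order structure satisfying the
  above axioms, i.e. those of ZF, in the two-valued sense, with [≈] read as
  equality.  It need not be well-founded, and its schemas only concern
  first-order definable (with parameters) classes; hence all the recursions
  below are carried out inside the model. *)

Definition scons T (x : T) (r : nat -> T) (n : nat) : T :=
  if n is m.+1 then r m else x.

Definition eval_term T (r : nat -> T) (t : term T) : T :=
  match t with Var n => r n | Cst c => c end.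

Fixpoint sat T (R : T -> T -> Prop) (r : nat -> T) (p : formula T) : Prop :=
  match p with
  | FBot => False
  | FIn t s => R (eval_term r t) (eval_term r s)
  | FEq t s => eval_term r t = eval_term r s
  | FImp p q => sat R r p -> sat R r q
  | FAnd p q => sat R r p /\ sat R r q
  | FOr p q => sat R r p \/ sat R r q
  | FNot p => ~ sat R r p
  | FEx p => exists x, sat R (scons x r) p
  | FAll p => forall x, sat R (scons x r) p
  end.

Record set_model := SetModel {
  set_model_sort :> Type;
  elt : set_model_sort -> set_model_sort -> Prop;
  set_modelP : forall p : formula set_model_sort, set_axiom p ->
    forall r : nat -> set_model_sort, sat elt r p }.

Declare Scope V_scope.
Delimit Scope V_scope with V.
Notation "x ∈ y" := (elt x y) : V_scope.
Local Open Scope V_scope.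

Section SetNotions.
Variable V : set_model.
Implicit Types x y z p f a b : V.

Definition is_pair z a b : Prop := forall t, t ∈ z <-> t = a \/ t = b.

(* Kuratowski: p = {{a, a}, {a, b}} *)
Definition is_opair p a b : Prop :=
  forall z, z ∈ p <-> is_pair z a a \/ is_pair z a b.

(* (a, b) ∈ f *)
Definition maps f a b : Prop := exists2 p, is_opair p a b & p ∈ f.

(* ((a1, a2), b) ∈ f *)
Definition maps2 f a1 a2 b : Prop := exists2 p, is_opair p a1 a2 & maps f p b.

Definition is_function f : Prop :=
  (forall p, p ∈ f -> exists a b, is_opair p a b) /\
  (forall a b b', maps f a b -> maps f a b' -> b = b').

Definition in_dom f a : Prop := exists b, maps f a b.

Definition is_transitive x : Prop := forall y z, y ∈ x -> z ∈ y -> z ∈ x.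

(* as the model satisfies Regularity, ordinals are the transitive sets of
   transitive sets *)
Definition is_ordinal x : Prop :=
  is_transitive x /\ forall y, y ∈ x -> is_transitive y.

End SetNotions.

(** * Complete Boolean algebras of a model

  [A] is a complete Boolean algebra of [V] when, its elements being identified
  with elements of [V] along the injection [code], its underlying set and its
  order are elements of [V], and its subsets that are elements of [V] have
  suprema and infima in [A]. *)
Record complete_in (V : set_model) d (A : ctbDistrLatticeType d)
    (code : A -> V) : Prop := CompleteIn {
  code_inj : injective code;
  carrier_in : exists X : V, forall p, p ∈ X <-> exists a, p = code a;
  order_in : exists R : V, forall p,
    p ∈ R <-> exists a b, a <= b /\ is_opair p (code a) (code b);
  sup_in : forall X : V, supremums [set a | code a ∈ X] !=set0;
  inf_in : forall X : V, infimums [set a | code a ∈ X] !=set0 }.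

(** * The Boolean-valued model *)

Section BooleanValuedModel.
Variables (V : set_model) (d : Order.disp_t) (A : ctbDistrLatticeType d).
Variable code : A -> V.

Local Notation Sup := (@supremum d A \bot).
Local Notation Inf := (@infimum d A \top).

(* Joins and meets of [V]-definable subsets of [A] exist in a complete algebra,
   so the default values of [supremum] and [infimum] are only used for empty
   sets, where they are the right ones. *)

Definition bimp (a b : A) : A := ~` a `|` b.

(* f is the function ξ |-> V_ξ^A on some ordinal *)
Definition is_hierarchy (f : V) : Prop :=
  [/\ is_function f,
      exists2 al, is_ordinal al & forall xi, in_dom f xi <-> xi ∈ al
    & forall xi S, maps f xi S -> forall x, x ∈ S <->
        [/\ is_function x,
            forall y z, maps x y z -> exists a, z = code a
          & exists zeta T, [/\ zeta ∈ xi, maps f zeta T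
                              & forall y, in_dom x y -> y ∈ T]]].

(* x ∈ V_ξ^A *)
Definition in_stage (xi x : V) : Prop :=
  exists f S, [/\ is_hierarchy f, maps f xi S & x ∈ S].

Definition in_VA (x : V) : Prop := exists2 xi, is_ordinal xi & in_stage xi x.

Definition VA : Type := {x : V | in_VA x}.

(* [mm] and [ee] are the functions (u, v) |-> ‖u ∈ v‖ and (u, v) |-> ‖u ≈ v‖ on
   a set D of elements of V^A that contains the domains of its elements *)
Definition is_interpretation (D mm ee : V) : Prop :=
  [/\ (forall u, u ∈ D -> in_VA u),
      (forall u x, u ∈ D -> in_dom u x -> x ∈ D),
      is_function mm, is_function ee
    & forall u v, u ∈ D -> v ∈ D ->
        maps2 mm u v (code
          (Sup [set b | exists x p q, [/\ maps v x (code p),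
                  maps2 ee x u (code q) & b = p `&` q]])) /\
        maps2 ee u v (code
          (Inf [set b | exists x p q, [/\ maps u x (code p),
                  maps2 mm x v (code q) & b = bimp p q]] `&`
           Inf [set b | exists x p q, [/\ maps v x (code p),
                  maps2 mm x u (code q) & b = bimp p q]]))].

(* ‖u ∈ v‖ *)
Definition val_in (u v : V) : A :=
  xget \bot [set a | exists D mm ee, [/\ is_interpretation D mm ee,
                       u ∈ D, v ∈ D & maps2 mm u v (code a)]].

(* ‖u ≈ v‖ *)
Definition val_eq (u v : V) : A :=
  xget \bot [set a | exists D mm ee, [/\ is_interpretation D mm ee,
                       u ∈ D, v ∈ D & maps2 ee u v (code a)]].

(* ‖p‖, the free variables being replaced by constants along [r] *)
Fixpoint value (r : nat -> VA) (p : formula VA) : A :=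
  match p with
  | FBot => \bot
  | FIn t s => val_in (sval (eval_term r t)) (sval (eval_term r s))
  | FEq t s => val_eq (sval (eval_term r t)) (sval (eval_term r s))
  | FImp p q => bimp (value r p) (value r q)
  | FAnd p q => value r p `&` value r q
  | FOr p q => value r p `|` value r q
  | FNot p => ~` value r p
  | FEx p => Sup [set b | exists u : VA, b = value (scons u r) p]
  | FAll p => Inf [set b | exists u : VA, b = value (scons u r) p]
  end.

(* for an open formula: every closed instance of it is valid *)
Definition valid (p : formula VA) : Prop := forall r, value r p = \top.

End BooleanValuedModel.

(* Main.v *)
Require Import Defs.
From mathcomp Require Import all_boot all_order.
From mathcomp Require Import boolp classical_sets.

Set Implicit Arguments.
Unset Strict Implicit.
Unset Printing Implicit Defensive.

Import Order.Def Order.Theory.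
Local Open Scope classical_set_scope.
Local Open Scope order_scope.
Local Open Scope V_scope.

(** The proof has two layers.

  The first one takes place in set theory.  The model [V] is an arbitrary
  structure satisfying the ZF axioms, so recursion and induction are available
  only inside [V], for classes that are first-order definable with parameters.
  Definability is therefore carried along as an explicit hypothesis
  ([definable], [definable_fun]) and closed under all the constructions that
  occur, including suprema and infima in [A] of definable families, which exist
  because a definable subset of [A] is an element of [V] ([codes_set]).  The two
  transfinite recursions are solved by approximations: a set is an approximation
  when it satisfies the recursive clause, induction shows that approximations
  agree ([stage_uniq], [eq_value_uniq]) and that they exist ([stage_ex],
  [eq_value_ex]).  The first recursion yields that V^A consists of the functions
  into [A] whose domain is included in V^A ([VA_dom], [VA_intro]) and the
  corresponding induction ([VA_ind]).  The second one yields total definable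
  functions [eqv] and [memv] that compute the truth values of the atomic formulas
  ([value_eqE], [value_inE]) and satisfy the defining equations.

  The second layer is the usual Boolean-valued argument.  It is phrased with
  inequalities [c <= ‖p‖], read as: the condition [c] forces [p].  Each connective
  then has introduction and elimination rules in which [c] may be shrunk, and
  derivations in [V^A] look like derivations in natural deduction.  After
  Leibniz's law ([value_leibniz]), the axioms that assert the existence of a set
  {z | p(z)} follow from a single principle ([comprehension]): it is enough to
  find in [V] a set [D] of names such that every [z] is equal to a member of [D]
  to the extent that [p(z)] holds.  For Collection, the set [D] comes from
  Collection in [V] applied to pairs of a member of the domain and a truth value;
  for Infinity, it is a stage V^A_al where [al] is a limit ordinal, because such a stage
  is closed under successors.  Induction is [VA_ind]. *)

(** * Renaming and substitution *)

Lemma scons_up_ren T (x : T) r f :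
  (fun n => scons x r (up_ren f n)) = scons x (fun n => r (f n)).
Proof. by apply/funext => -[]. Qed.

Lemma eval_rename_term T (r : nat -> T) f t :
  eval_term r (rename_term f t) = eval_term (fun n => r (f n)) t.
Proof. by case: t. Qed.

Lemma sat_rename T (R : T -> T -> Prop) p : forall f r,
  sat R r (rename f p) = sat R (fun n => r (f n)) p.
Proof.
elim: p => //= [t s|t s|p IHp q IHq|p IHp q IHq|p IHp q IHq|p IHp|p IHp|p IHp]
  f r; rewrite ?eval_rename_term ?IHp ?IHq //.
- by congr ex; apply/funext => x; rewrite IHp scons_up_ren.
- by apply: eq_forall => x; rewrite IHp scons_up_ren.
Qed.

Definition subst_term C (s : nat -> term C) (t : term C) : term C :=
  if t is Var n then s n else t.

Definition up_subst C (s : nat -> term C) (n : nat) : term C :=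
  if n is m.+1 then rename_term succn (s m) else Var 0.

Fixpoint subst C (s : nat -> term C) (p : formula C) : formula C :=
  match p with
  | FBot => FBot
  | FIn t u => FIn (subst_term s t) (subst_term s u)
  | FEq t u => FEq (subst_term s t) (subst_term s u)
  | FImp p q => FImp (subst s p) (subst s q)
  | FAnd p q => FAnd (subst s p) (subst s q)
  | FOr p q => FOr (subst s p) (subst s q)
  | FNot p => FNot (subst s p)
  | FEx p => FEx (subst (up_subst s) p)
  | FAll p => FAll (subst (up_subst s) p)
  end.

Lemma scons_up_subst T (x : T) r s :
  (fun n => eval_term (scons x r) (up_subst s n)) =
  scons x (fun n => eval_term r (s n)).
Proof. by apply/funext => -[//|n] /=; rewrite eval_rename_term. Qed.

Lemma eval_subst_term T (r : nat -> T) s t :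
  eval_term r (subst_term s t) = eval_term (fun n => eval_term r (s n)) t.
Proof. by case: t. Qed.

Lemma sat_subst T (R : T -> T -> Prop) p : forall s r,
  sat R r (subst s p) = sat R (fun n => eval_term r (s n)) p.
Proof.
elim: p => //= [t u|t u|p IHp q IHq|p IHp q IHq|p IHp q IHq|p IHp|p IHp|p IHp]
  s r; rewrite ?eval_subst_term ?IHp ?IHq //.
- by congr ex; apply/funext => x; rewrite IHp scons_up_subst.
- by apply: eq_forall => x; rewrite IHp scons_up_subst.
Qed.

(** * Definable classes *)

Section Definability.
Variable V : set_model.
Local Notation env := (nat -> V).
Implicit Types (P Q : env -> Prop) (s t : env -> V).

(** The classes to which the schemas of the model apply, presented by their free
  variables.  Constants of the language serve as parameters. *)
Definition definable P := exists p, forall r, sat (@elt V) r p = P r.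

(** The graph of [t] is definable, its value being the variable of index 0. *)
Definition definable_fun t := definable (fun r => r 0 = t (fun n => r n.+1)).

Lemma def_ext P Q : (forall r, P r <-> Q r) -> definable P -> definable Q.
Proof.
by move=> PQ; suff -> : P = Q by []; apply/funext => r; apply/propext.
Qed.

Lemma def_subst P (s : nat -> term V) :
  definable P -> definable (fun r => P (fun n => eval_term r (s n))).
Proof. by move=> [p hp]; exists (subst s p) => r; rewrite sat_subst hp. Qed.

Lemma def_ren P f : definable P -> definable (fun r => P (fun n => r (f n))).
Proof. exact: (def_subst (fun n => Var (f n))). Qed.

Lemma dfun_ren t f : definable_fun t ->
  definable_fun (fun r => t (fun n => r (f n))).
Proof. exact: (def_ren (up_ren f)). Qed.

Lemma dfun_var k : definable_fun (fun r => r k).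
Proof. by exists (FEq (Var 0) (Var k.+1)). Qed.

Lemma dfun_cst c : definable_fun (fun=> c).
Proof. by exists (FEq (Var 0) (Cst c)). Qed.

Lemma def_prop (b : Prop) : definable (fun=> b).
Proof.
case: (pselect b) => hb; [exists (FImp FBot FBot)|exists FBot] => r /=.
  by apply/propext; tauto.
by apply/propext; tauto.
Qed.

Lemma def_and P Q : definable P -> definable Q -> definable (fun r => P r /\
  Q r).
Proof. by move=> [p hp] [q hq]; exists (FAnd p q) => r /=; rewrite hp hq. Qed.

Lemma def_or P Q : definable P -> definable Q ->
  definable (fun r => P r \/ Q r).
Proof. by move=> [p hp] [q hq]; exists (FOr p q) => r /=; rewrite hp hq. Qed.

Lemma def_imp P Q : definable P -> definable Q -> definable (fun r => P r ->
  Q r).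
Proof. by move=> [p hp] [q hq]; exists (FImp p q) => r /=; rewrite hp hq. Qed.

Lemma def_not P : definable P -> definable (fun r => ~ P r).
Proof. by move=> [p hp]; exists (FNot p) => r /=; rewrite hp. Qed.

Lemma def_iff P Q : definable P -> definable Q ->
  definable (fun r => P r <-> Q r).
Proof. by move=> hP hQ; apply: def_and; apply: def_imp. Qed.

Lemma def_and3 P Q R : definable P -> definable Q -> definable R ->
  definable (fun r => [/\ P r, Q r & R r]).
Proof.
move=> hP hQ hR; apply: (def_ext _ (def_and hP (def_and hQ hR))) => r.
by split => [[? []]|[]].
Qed.

Lemma def_and4 P Q R S : definable P -> definable Q -> definable R ->
  definable S ->
  definable (fun r => [/\ P r, Q r, R r & S r]).
Proof.
move=> hP hQ hR hS.
apply: (def_ext _ (def_and hP (def_and hQ (def_and hR hS)))) => r.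
by split => [[? [? []]]|[]].
Qed.

(** The quantified variable becomes the variable of index 0.  Since [P] is applied
  to bound variables only, unification finds it: the lemma can be applied
  mechanically to any class written with quantifiers. *)
Lemma def_ex (P : V -> env -> Prop) :
  definable (fun r => P (r 0) (fun n => r n.+1)) ->
    definable (fun r => exists x, P x r).
Proof.
by move=> [p hp]; exists (FEx p) => r /=; congr ex; apply/funext => x;
  rewrite hp.
Qed.

Lemma def_all (P : V -> env -> Prop) :
  definable (fun r => P (r 0) (fun n => r n.+1)) ->
    definable (fun r => forall x, P x r).
Proof.
by move=> [p hp]; exists (FAll p) => r /=; apply: eq_forall => x; rewrite hp.
Qed.

Lemma def_ex2 (P Q : V -> env -> Prop) :
  definable (fun r => P (r 0) (fun n => r n.+1)) ->
  definable (fun r => Q (r 0) (fun n => r n.+1)) ->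
  definable (fun r => exists2 x, P x r & Q x r).
Proof.
move=> hP hQ; apply: (@def_ext (fun r => exists x, P x r /\ Q x r)).
  by move=> r; split=> [[x []]|[x]]; exists x.
by apply: def_ex; apply: def_and.
Qed.

(** A definable function can be substituted in a definable class: [F (t r)] says
  that some element is equal to [t r] and satisfies [F]. *)
Lemma def_app1 (F : V -> Prop) t :
  definable (fun r => F (r 0)) -> definable_fun t ->
    definable (fun r => F (t r)).
Proof.
move=> hF ht; apply: (@def_ext (fun r => exists x, x = t r /\ F x)).
  by move=> r; split=> [[_ [->]]|] //; exists (t r).
by apply: def_ex; apply: def_and.
Qed.

Lemma def_app2 (F : V -> V -> Prop) s t :
  definable (fun r => F (r 0) (r 1)) -> definable_fun s -> definable_fun t ->
  definable (fun r => F (s r) (t r)).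
Proof.
move=> hF hs ht; apply: (@def_ext (fun r => exists y, y = t r /\
    exists x, x = s r /\ F x y)).
  move=> r; split=> [[_ [-> [_ [->]]]]|] //.
  by exists (t r); split=> //; exists (s r).
apply: def_ex; apply: def_and => //.
by apply: def_ex; apply: def_and => //; apply: (dfun_ren succn hs).
Qed.

Lemma def_app3 (F : V -> V -> V -> Prop) s t u :
  definable (fun r => F (r 0) (r 1) (r 2)) -> definable_fun s ->
    definable_fun t -> definable_fun u ->
  definable (fun r => F (s r) (t r) (u r)).
Proof.
move=> hF hs ht hu; apply: (@def_ext (fun r => exists z, z = u r /\
    exists y, y = t r /\ exists x, x = s r /\ F x y z)).
  move=> r; split=> [[_ [-> [_ [-> [_ [->]]]]]]|] //.
  by exists (u r); split=> //; exists (t r); split=> //; exists (s r).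
apply: def_ex; apply: def_and => //.
apply: def_ex; apply: def_and; first exact: (dfun_ren succn ht).
by apply: def_ex; apply: def_and => //; apply: (dfun_ren (addn 2) hs).
Qed.

Lemma def_app4 (F : V -> V -> V -> V -> Prop) s t u v :
  definable (fun r => F (r 0) (r 1) (r 2) (r 3)) ->
  definable_fun s -> definable_fun t -> definable_fun u -> definable_fun v ->
  definable (fun r => F (s r) (t r) (u r) (v r)).
Proof.
move=> hF hs ht hu hv; apply: (@def_ext (fun r => exists a, a = v r /\
    exists z, z = u r /\ exists y, y = t r /\ exists x, x = s r /\ F x y z a)).
  move=> r; split=> [[_ [-> [_ [-> [_ [-> [_ [->]]]]]]]]|] //.
  exists (v r); split=> //; exists (u r); split=> //.
  by exists (t r); split=> //; exists (s r).
apply: def_ex; apply: def_and => //.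
apply: def_ex; apply: def_and; first exact: (dfun_ren succn hu).
apply: def_ex; apply: def_and; first exact: (dfun_ren (addn 2) ht).
by apply: def_ex; apply: def_and => //; apply: (dfun_ren (addn 3) hs).
Qed.

Lemma def_in s t : definable_fun s -> definable_fun t ->
  definable (fun r => s r ∈ t r).
Proof. by apply: def_app2; exists (FIn (Var 0) (Var 1)). Qed.

Lemma def_eq s t : definable_fun s -> definable_fun t ->
  definable (fun r => s r = t r).
Proof. by apply: def_app2; exists (FEq (Var 0) (Var 1)). Qed.

End Definability.

(** Proves definability by following the syntax of a class.  The two hooks are
  extended each time that new notions are shown to be definable; they come before
  the logical rules, which would otherwise unfold these notions. *)
Ltac dfun_more := fail.
Ltac def_more := fail.

Ltac def_step := cbv beta;
  lazymatch goal with
  | |- definable_fun _ =>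
      first [assumption | apply dfun_var | apply dfun_cst | dfun_more]
  | |- definable _ => first
      [ assumption
      | match goal with
        | H : definable (fun r => ?P (r 0)) |- definable (fun r => ?P _) =>
            apply (def_app1 H)
        | H : definable (fun r => ?P (r 0) (r 1)) |- definable (fun r => ?P _ _) =>
            apply (def_app2 H)
        | H : definable (fun r => ?P (r 0) (r 1) (r 2)) |- definable (fun r => ?P _ _ _) =>
            apply (def_app3 H)
        end
      | def_more
      | apply def_and | apply def_or | apply def_not | apply def_iff
      | apply def_and3 | apply def_and4
      | apply def_ex2 | apply def_ex | apply def_in | apply def_eq
      | apply def_imp | apply def_all ]
  end.
Ltac defauto := repeat def_step.

(** * Set theory inside the model *)

Section SetTheory.
Variable V : set_model.
Implicit Types x y z w a b p f : V.

Lemma is_pair_def (s t u : (nat -> V) -> V) : definable_fun s ->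
  definable_fun t -> definable_fun u ->
  definable (fun r => is_pair (s r) (t r) (u r)).
Proof. by apply: def_app3; rewrite /is_pair; defauto. Qed.

Lemma is_opair_def (s t u : (nat -> V) -> V) : definable_fun s ->
  definable_fun t -> definable_fun u ->
  definable (fun r => is_opair (s r) (t r) (u r)).
Proof. by apply: def_app3; rewrite /is_opair /is_pair; defauto. Qed.

Lemma maps_def (s t u : (nat -> V) -> V) : definable_fun s ->
  definable_fun t -> definable_fun u ->
  definable (fun r => maps (s r) (t r) (u r)).
Proof. by apply: def_app3; rewrite /maps /is_opair /is_pair; defauto. Qed.

Lemma maps2_def (s t u v : (nat -> V) -> V) : definable_fun s ->
  definable_fun t -> definable_fun u ->
  definable_fun v -> definable (fun r => maps2 (s r) (t r) (u r) (v r)).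
Proof. by apply: def_app4; rewrite /maps2 /maps /is_opair /is_pair;
  defauto. Qed.

Lemma in_dom_def (s t : (nat -> V) -> V) : definable_fun s -> definable_fun t ->
  definable (fun r => in_dom (s r) (t r)).
Proof. by apply: def_app2; rewrite /in_dom /maps /is_opair /is_pair;
  defauto. Qed.

Lemma is_function_def (s : (nat -> V) -> V) : definable_fun s ->
  definable (fun r => is_function (s r)).
Proof. by apply: def_app1; rewrite /is_function /maps /is_opair /is_pair;
  defauto. Qed.

Lemma is_transitive_def (s : (nat -> V) -> V) : definable_fun s ->
  definable (fun r => is_transitive (s r)).
Proof. by apply: def_app1; rewrite /is_transitive; defauto. Qed.

Lemma is_ordinal_def (s : (nat -> V) -> V) : definable_fun s ->
  definable (fun r => is_ordinal (s r)).
Proof. by apply: def_app1; rewrite /is_ordinal /is_transitive; defauto. Qed.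


Lemma elt_ext x y : (forall z, z ∈ x <-> z ∈ y) -> x = y.
Proof. by move/(set_modelP (Extensionality V) (fun=> x) x y). Qed.

Lemma pairing_ex x y : exists w, is_pair w x y.
Proof. exact: (set_modelP (Pairing V) (fun=> x) x y). Qed.

Lemma union_ex x : exists w, forall z, z ∈ w <-> exists2 y, y ∈ x & z ∈ y.
Proof.
have [w hw] := set_modelP (Union V) (fun=> x) x; exists w => z.
by have [h1 h2] := hw z; split=> [/h1[y []]|[y ? ?]]; [exists y|apply: h2;
  exists y].
Qed.

Lemma powerset_ex x : exists w, forall z, z ∈ w <-> forall y, y ∈ z -> y ∈ x.
Proof. by have [w hw] := set_modelP (Powerset V) (fun=> x) x; exists w. Qed.

Lemma separation (P : V -> Prop) x : definable (fun r => P (r 0)) ->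
  exists w, forall z, z ∈ w <-> z ∈ x /\ P z.
Proof.
move=> [p hp]; have /= /(_ x) [w hw] := set_modelP (Separation p) (fun=> x).
by exists w => z; have := hw z; rewrite sat_rename hp.
Qed.

Lemma collection (P : V -> V -> Prop) x : definable (fun r => P (r 0) (r 1)) ->
  (forall y, y ∈ x -> exists z, P y z) ->
  exists w, forall y, y ∈ x -> exists2 z, z ∈ w & P y z.
Proof.
move=> /(def_ren (fun n => if n is 0 then 1 else 0)) [p hp] hx.
have /= /(_ x) [|w hw] := set_modelP (Collection p) (fun=> x).
  by move=> y /hx[z hz]; exists z; rewrite hp.
exists w => y /hw[z [zw]]; rewrite sat_rename hp /=; by exists z.
Qed.

Lemma elt_ind (P : V -> Prop) : definable (fun r => P (r 0)) ->
  (forall x, (forall y, y ∈ x -> P y) -> P x) -> forall x, P x.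
Proof.
move=> [p hp] hx x; have /= := set_modelP (Regularity p) (fun=> x).
move=> /(_ _ x); rewrite hp; apply=> y hy; rewrite hp; apply: hx => z /hy.
by rewrite sat_rename hp.
Qed.

Lemma empty_set (x : V) : exists w : V, forall z, ~ z ∈ w.
Proof.
have [w hw] := @separation (fun=> False) x (def_prop V False).
by exists w => z /hw[].
Qed.

Lemma infinity (x : V) : exists I : V,
  (exists2 e, (forall z, ~ z ∈ e) & e ∈ I) /\
  (forall y, y ∈ I -> exists2 s, (forall z, z ∈ s <-> z ∈ y \/ z = y) & s ∈ I).
Proof.
have [I [[e [he eI]] hI]] := set_modelP (Infinity V) (fun=> x).
exists I; split; last by move=> y /hI[s [hs sI]]; exists s.
by exists e => // z; have [h _] := he z; move/h; apply.
Qed.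

Lemma binary_union x y : exists w, forall z, z ∈ w <-> z ∈ x \/ z ∈ y.
Proof.
have [p hp] := pairing_ex x y; have [w hw] := union_ex p; exists w => z.
split=> [/hw[t /hp[]-> ?]|[] ?]; [by left|by right| |]; apply/hw.
  by exists x => //; apply/hp; left.
by exists y => //; apply/hp; right.
Qed.

Lemma add_element x y : exists w, forall z, z ∈ w <-> z ∈ x \/ z = y.
Proof.
have [p hp] := pairing_ex y y; have [w hw] := binary_union x p; exists w => z.
by rewrite hw hp; tauto.
Qed.

Lemma replacement (P : V -> V -> Prop) x : definable (fun r => P (r 0) (r 1)) ->
  (forall y, y ∈ x -> exists2 z, P y z & forall z', P y z' -> z' = z) ->
  exists w, forall z, z ∈ w <-> exists2 y, y ∈ x & P y z.
Proof.
move=> dP hP; have [|w hw] := collection dP (x := x).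
  by move=> y /hP[z ? _]; exists z.
have [|v hv] := @separation (fun z => exists2 y, y ∈ x & P y z) w.
  by defauto.
exists v => z; rewrite hv; split=> [[]|] // zP.
split=> //; have [y yx yz] := zP; have [z' z'w yz'] := hw _ yx.
by have [t _ ht] := hP _ yx; rewrite (ht _ yz) -(ht _ yz').
Qed.

Lemma elt_irrefl x : ~ x ∈ x.
Proof.
apply: (@elt_ind (fun x => ~ x ∈ x)); first by defauto.
by move=> y hy yy; apply: (hy y).
Qed.

Lemma opair_ex a b : exists p, is_opair p a b.
Proof.
have [s hs] := pairing_ex a a; have [t ht] := pairing_ex a b.
have [p hp] := pairing_ex s t; exists p => z; rewrite hp.
have eq_pair (u v c e : V) : is_pair u c e -> v = u <-> is_pair v c e.
  move=> hu; split=> [->//|hv]; apply: elt_ext => y.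
  by rewrite (hu y) (hv y).
by have := eq_pair _ z _ _ hs; have := eq_pair _ z _ _ ht; tauto.
Qed.

Lemma opair_uniq p q a b : is_opair p a b -> is_opair q a b -> p = q.
Proof. by move=> hp hq; apply: elt_ext => z; rewrite hp hq. Qed.

Lemma opair_inj p a b a' b' :
  is_opair p a b -> is_opair p a' b' -> a = a' /\ b = b'.
Proof.
move=> h h'.
have [s hs] := pairing_ex a a; have [t ht] := pairing_ex a b.
have [s' hs'] := pairing_ex a' a'; have [t' ht'] := pairing_ex a' b'.
have inP (u c e : V) : is_pair u c e -> c ∈ u /\ e ∈ u.
  by move=> hu; split; apply/hu; [left|right].
have aa : a = a'.
  have /h' : s ∈ p by apply/h; left.
  case=> [/inP[/hs[]]|/inP[/hs[]]] //.
split=> //; subst a'.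
have second_in (c e c' e' u : V) : is_pair u c e -> is_pair u c' e' ->
  e = c' \/ e = e'.
  by move=> hu hu'; apply/hu'/hu; right.
have hb : b = a \/ b = b'.
  have /h'[] : t ∈ p by apply/h; right.
    by move/(second_in _ _ _ _ _ ht); tauto.
  by move/(second_in _ _ _ _ _ ht).
have hb' : b' = a \/ b' = b.
  have /h[] : t' ∈ p by apply/h'; right.
    by move/(second_in _ _ _ _ _ ht'); tauto.
  by move/(second_in _ _ _ _ _ ht').
by case: hb hb' => [->|->] // [->|->].
Qed.

(** The graph of a definable relation between two sets is a set: it is cut out
  of the double power set of their union. *)
Lemma relation_set (P : V -> V ->
  Prop) D E : definable (fun r => P (r 0) (r 1)) ->
  exists f, (forall p, p ∈ f -> exists a b, is_opair p a b) /\
    forall a b, maps f a b <-> [/\ a ∈ D, b ∈ E & P a b].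
Proof.
move=> dP; have [U hU] := binary_union D E.
have [P1 hP1] := powerset_ex U; have [P2 hP2] := powerset_ex P1.
have [|f hf] := @separation (fun p => exists a b,
    [/\ a ∈ D, b ∈ E, P a b & is_opair p a b]) P2; first by defauto.
exists f; split.
  by move=> p /hf[_ [a [b []]]]; exists a, b.
move=> a b; split=> [[p hp /hf[_ [a' [b' [aD bE Pab hp']]]]]|[aD bE Pab]].
  by have [-> ->] := opair_inj hp hp'.
have [p hp] := opair_ex a b; exists p => //; apply/hf; split; last
  by exists a, b.
apply/hP2 => u /hp hu; apply/hP1 => t; case: hu => hu /hu[->|->]; apply/hU;
  by [left|right].
Qed.

End SetTheory.

Ltac def_sets := first
  [ apply is_pair_def | apply is_opair_def | apply maps_def | apply maps2_def
  | apply in_dom_def | apply is_function_def | apply is_transitive_def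
  | apply is_ordinal_def ].
Ltac def_more ::= def_sets.

(** * The complete Boolean algebra seen from the model *)

Section Algebra.
Variables (V : set_model) (d : Order.disp_t) (A : ctbDistrLatticeType d).
Variables (code : A -> V) (hA : complete_in code).
Local Notation env := (nat -> V).
Local Notation Sup := (@supremum d A \bot).
Local Notation Inf := (@infimum d A \top).

(** Turns quantification over [A] into quantification over the model. *)
Definition decode (z : V) : A := xget \bot (fun a => z = code a).

Lemma codeK : cancel code decode.
Proof. by move=> a; apply: xget_unique => // b /(code_inj hA). Qed.

Lemma def_code_ex (t : env -> V) : definable_fun t ->
  definable (fun r => exists a, t r = code a).
Proof.
have [X hX] := carrier_in hA => dt.
by apply: (@def_ext _ (fun r => t r ∈ X)) => [r|]; [exact: hX|defauto].
Qed.

Lemma def_exA (P : A -> env -> Prop) :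
  definable (fun r => P (decode (r 0)) (fun n => r n.+1)) ->
  definable (fun r => exists a, P a r).
Proof.
move=> dP; apply: (@def_ext _ (fun r =>
    exists x, (exists a, x = code a) /\ P (decode x) r)).
  move=> r; split=> [[x [_ Px]]|[a Pa]]; first by exists (decode x).
  by exists (code a); split; [exists a|rewrite codeK].
by apply: def_ex; apply: def_and => //; apply: def_code_ex; defauto.
Qed.

Lemma def_allA (P : A -> env -> Prop) :
  definable (fun r => P (decode (r 0)) (fun n => r n.+1)) ->
  definable (fun r => forall a, P a r).
Proof.
move=> dP; apply: (@def_ext _ (fun r => forall x, P (decode x) r)).
  by move=> r; split=> // h a; rewrite -(codeK a).
exact: def_all.
Qed.

Lemma dfun_app1 (F : V -> V) t :
  definable (fun r => r 0 = F (r 1)) -> definable_fun t ->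
    definable_fun (fun r => F (t r)).
Proof.
move=> dF dt; apply: (@def_app2 _ (fun x y => x = F y)) => //.
  exact: dfun_var.
exact: (dfun_ren succn dt).
Qed.

Lemma dfun_decode t : definable_fun t ->
  definable_fun (fun r => code (decode (t r))).
Proof.
apply: (dfun_app1 (F := fun x => code (decode x))).
apply: (@def_ext _ (fun r => (exists a, r 1 = code a) /\ r 0 = r 1 \/
    ~ (exists a, r 1 = code a) /\ r 0 = code \bot)).
  move=> r; split=> [[[[a ->] ->]|[h ->]]|->].
  - by rewrite codeK.
  - by rewrite /decode xgetPN // => a ha; apply: h; exists a.
  case: (pselect (exists a, r 1 = code a)) => h; [left|right]; split=> //.
    by case: h => a ->; rewrite codeK.
  by rewrite /decode xgetPN // => a ha; apply: h; exists a.
apply: def_or; apply: def_and; try apply: def_not; try apply: def_code_ex;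
  defauto.
Qed.

Lemma def_le (s t : env -> A) : definable_fun (fun r => code (s r)) ->
  definable_fun (fun r => code (t r)) -> definable (fun r => s r <= t r).
Proof.
have [R hR] := order_in hA => ds dt.
apply: (@def_ext _ (fun r => (fun x y => exists2 p, is_opair p x y & p ∈ R)
    (code (s r)) (code (t r)))).
  move=> r; split=> [[p hp /hR[a [b [ab hp']]]]|st].
    by have [/(code_inj hA)-> /(code_inj hA)->] := opair_inj hp hp'.
  have [p hp] := opair_ex (code (s r)) (code (t r)).
  by exists p => //; apply/hR; exists (s r), (t r).
by apply: (def_app2 (F := fun x y => exists2 p, is_opair p x y & p ∈ R));
  defauto.
Qed.

Lemma def_eqA (s t : env -> A) : definable_fun (fun r => code (s r)) ->
  definable_fun (fun r => code (t r)) -> definable (fun r => s r = t r).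
Proof.
move=> ds dt; apply: (@def_ext _ (fun r => code (s r) = code (t r))).
  by move=> r; split=> [/(code_inj hA)|->].
exact: def_eq.
Qed.

Ltac def_algebra := first
  [ apply def_exA | apply def_allA | apply def_eqA | apply def_le ].
Ltac def_more ::= first [ def_sets | def_algebra ].
Ltac dfun_more ::= apply dfun_decode.

(** The operations of [A] are characterized by first-order conditions on its order,
  so that the definability of the order is enough for all of them. *)
Lemma dfun_graph (t : env -> A) (G : A -> env -> Prop) :
  (forall a r, G a r <-> a = t r) ->
  definable (fun r => G (decode (r 0)) (fun n => r n.+1)) ->
  definable_fun (fun r => code (t r)).
Proof.
move=> hG dG; apply: (@def_ext _ (fun r => (exists a, r 0 = code a) /\
    G (decode (r 0)) (fun n => r n.+1))).
  move=> r; split=> [[[a e]] | e].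
    by rewrite e codeK => /hG ->.
  by split; [rewrite e; eexists|apply/hG; rewrite e codeK].
by apply: def_and => //; apply: def_code_ex; defauto.
Qed.

Lemma dfun_op2 (op : A -> A -> A) (s t : env -> A) :
  definable (fun r => decode (r 0) = op (decode (r 1)) (decode (r 2))) ->
  definable_fun (fun r => code (s r)) -> definable_fun (fun r => code (t r)) ->
  definable_fun (fun r => code (op (s r) (t r))).
Proof.
move=> dop ds dt.
apply: (@dfun_graph _ (fun a r =>
  (fun x y z => decode x = op (decode y) (decode z))
    (code a) (code (s r)) (code (t r)))).
  by move=> a r; rewrite !codeK.
apply: (def_app3 (F := fun x y z => decode x = op (decode y) (decode z))) => //.
- by defauto.
- exact: (dfun_ren succn ds).
- exact: (dfun_ren succn dt).
Qed.

Lemma dfun_meet (s t : env -> A) : definable_fun (fun r => code (s r)) ->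
  definable_fun (fun r => code (t r)) ->
    definable_fun (fun r => code (s r `&` t r)).
Proof.
apply: dfun_op2; apply: (@def_ext _ (fun r => forall b,
    b <= decode (r 0) <-> b <= decode (r 1) /\ b <= decode (r 2))).
  move=> r; split=> [h|-> b]; last by rewrite lexI; split=> /andP.
  apply/eqP; rewrite eq_le lexI; apply/andP; split.
    by apply/andP/h.
  by apply/h/andP; rewrite -lexI.
by defauto.
Qed.

Lemma dfun_join (s t : env -> A) : definable_fun (fun r => code (s r)) ->
  definable_fun (fun r => code (t r)) ->
    definable_fun (fun r => code (s r `|` t r)).
Proof.
apply: dfun_op2; apply: (@def_ext _ (fun r => forall b,
    decode (r 0) <= b <-> decode (r 1) <= b /\ decode (r 2) <= b)).
  move=> r; split=> [h|-> b]; last by rewrite leUx; split=> /andP.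
  apply/eqP; rewrite eq_le leUx; apply/andP; split.
    by apply/h/andP; rewrite -leUx.
  by apply/andP/h.
by defauto.
Qed.

Lemma dfun_compl (t : env -> A) :
  definable_fun (fun r => code (t r)) ->
    definable_fun (fun r => code (~` (t r))).
Proof.
(* a unary operation is a binary one that ignores its first argument *)
move=> dt; apply: (@dfun_op2 (fun _ x => ~` x) t t) => //.
apply: (@def_ext _ (fun r => decode (r 0) `&` decode (r 2) = \bot /\
    decode (r 0) `|` decode (r 2) = \top)).
  move=> r; split=> [[h1 h2]|->]; last by rewrite meetC meetxC joinC joinxC.
  rewrite -[LHS]meetx1 -(joinxC (decode (r 2))) meetUr h1 join0x.
  by rewrite -[RHS]meet1x -h2 meetUl meetxC joinx0.
apply: def_and; apply: def_eqA; try apply: dfun_meet; try apply: dfun_join;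
  by defauto.
Qed.

Lemma dfun_bimp (s t : env -> A) : definable_fun (fun r => code (s r)) ->
  definable_fun (fun r => code (t r)) ->
    definable_fun (fun r => code (bimp (s r) (t r))).
Proof. by move=> ds dt; apply: dfun_join => //; apply: dfun_compl. Qed.

Definition defA (B : set A) := definable (fun r => B (decode (r 0))).

(** Completeness only concerns the subsets of [A] that are elements of the model;
  by Separation from the carrier, the definable ones are. *)
Lemma codes_set (B : set A) : defA B ->
  exists X : V, [set a | code a ∈ X] = B.
Proof.
have [C hC] := carrier_in hA => dB.
have [|X hX] := @separation V (fun z => B (decode z)) C; first exact: dB.
exists X; apply/predeqP => a /=; rewrite hX codeK; split=> [[]|] // Ba.
by split=> //; apply/hC; exists a.
Qed.

Lemma Sup_le (B : set A) c : defA B -> Sup B <= c <-> forall b, B b -> b <= c.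
Proof.
move=> /codes_set[X hX]; have [x Bx] : (supremums B !=set0).
  by rewrite -hX; apply: sup_in.
rewrite /supremum; case: ifPn => [/eqP -> |_]; first by rewrite le0x.
have [ub lub] := xgetI \bot Bx; split=> [h b /ub bS|h]; last exact: lub.
exact: le_trans bS h.
Qed.

Lemma le_Inf (B : set A) c : defA B -> c <= Inf B <-> forall b, B b -> c <= b.
Proof.
move=> /codes_set[X hX]; have [x Bx] : (infimums B !=set0).
  by rewrite -hX; apply: inf_in.
rewrite /infimum; case: ifPn => [/eqP -> |_]; first by rewrite lex1.
have [lb glb] := xgetI \top Bx; split=> [h b /lb Ib|h]; last exact: glb.
exact: le_trans h Ib.
Qed.

(** The parameters become constants. *)
Lemma defA_param (B : A -> env -> Prop) r :
  definable (fun r => B (decode (r 0)) (fun n => r n.+1)) -> defA (B^~ r).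
Proof. by move/(def_subst (fun n => if n is m.+1 then Cst (r m) else Var 0)). Qed.

Lemma dfun_Sup (B : A -> env -> Prop) :
  definable (fun r => B (decode (r 0)) (fun n => r n.+1)) ->
  definable_fun (fun r => code (Sup [set b | B b r])).
Proof.
move=> dB; apply: (@dfun_graph _ (fun a r =>
    forall c, a <= c <-> forall b, B b r -> b <= c)).
  move=> a r; have hS := Sup_le _ (defA_param r dB).
  split=> [h|-> c]; last exact: hS.
  by apply/eqP; rewrite eq_le; apply/andP; split; [apply/h/hS|apply/hS/h].
apply: def_allA; apply: def_iff; first by defauto.
apply: def_allA; apply: def_imp; last by defauto.
exact: (def_ren (fun n => if n is m.+1 then m.+3 else 0) dB).
Qed.

Lemma dfun_Inf (B : A -> env -> Prop) :
  definable (fun r => B (decode (r 0)) (fun n => r n.+1)) ->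
  definable_fun (fun r => code (Inf [set b | B b r])).
Proof.
move=> dB; apply: (@dfun_graph _ (fun a r =>
    forall c, c <= a <-> forall b, B b r -> c <= b)).
  move=> a r; have hS c := le_Inf c (defA_param r dB).
  split=> [h|-> c]; last exact: hS.
  by apply/eqP; rewrite eq_le; apply/andP; split; [apply/hS/h|apply/h/hS].
apply: def_allA; apply: def_iff; first by defauto.
apply: def_allA; apply: def_imp; last by defauto.
exact: (def_ren (fun n => if n is m.+1 then m.+3 else 0) dB).
Qed.

Lemma dfun_xget (B : A -> env -> Prop) :
  (forall r a b, B a r -> B b r -> a = b) ->
  definable (fun r => B (decode (r 0)) (fun n => r n.+1)) ->
  definable_fun (fun r => code (xget \bot [set b | B b r])).
Proof.
move=> uB dB; apply: (@dfun_graph _ (fun a r =>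
    B a r \/ a = \bot /\ ~ exists b, B b r)).
  move=> a r; split=> [[Ba|[-> nB]]|->].
  - by rewrite (xget_unique \bot Ba) // => b /uB; apply.
  - by rewrite xgetPN // => b Bb; apply: nB; exists b.
  by case: xgetP => [b _ Bb|nB]; [left|right; split=> // -[b /nB]].
apply: def_or => //; apply: def_and; first by apply: def_eqA; defauto.
apply: def_not; apply: def_exA.
exact: (def_ren (fun n => if n is m.+1 then m.+2 else 0) dB).
Qed.

Lemma le_bimp (a b c : A) : (c <= bimp a b) = (c `&` a <= b).
Proof. by rewrite /bimp -leBLR diffE complK. Qed.

Ltac dfun_algebra := first
  [ apply dfun_decode | apply dfun_meet | apply dfun_join | apply dfun_compl
  | apply dfun_bimp | apply dfun_Sup | apply dfun_Inf ].
Ltac dfun_more ::= dfun_algebra.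

(** * The class of names *)

Local Notation in_VA := (in_VA code).
Local Notation in_stage := (in_stage code).
Local Notation is_hierarchy := (is_hierarchy code).

Definition is_name (x : V) : Prop :=
  is_function x /\ forall y z, maps x y z -> exists a, z = code a.

Definition name_over (T x : V) : Prop :=
  is_name x /\ forall y, in_dom x y -> y ∈ T.

Definition stage (xi S : V) : Prop := exists2 f, is_hierarchy f & maps f xi S.

Lemma is_name_def s : definable_fun s -> definable (fun r => is_name (s r)).
Proof. by apply: def_app1; rewrite /is_name; defauto. Qed.

Lemma name_over_def s t : definable_fun s -> definable_fun t ->
  definable (fun r => name_over (s r) (t r)).
Proof.
apply: def_app2; rewrite /name_over.
apply: def_and; [by apply: is_name_def; defauto|by defauto].
Qed.

Lemma is_hierarchy_def s : definable_fun s ->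
  definable (fun r => is_hierarchy (s r)).
Proof. by apply: def_app1; rewrite /Defs.is_hierarchy; defauto. Qed.

Lemma stage_def s t : definable_fun s -> definable_fun t ->
  definable (fun r => stage (s r) (t r)).
Proof.
apply: def_app2; apply: def_ex2; [by apply: is_hierarchy_def;
  defauto|by defauto].
Qed.

Lemma in_stage_def s t : definable_fun s -> definable_fun t ->
  definable (fun r => in_stage (s r) (t r)).
Proof.
apply: def_app2; rewrite /Defs.in_stage; apply: def_ex; apply: def_ex.
apply: def_and3; [by apply: is_hierarchy_def; defauto|by defauto|by defauto].
Qed.

Lemma in_VA_def s : definable_fun s -> definable (fun r => in_VA (s r)).
Proof.
apply: def_app1; apply: def_ex2; [by defauto|by apply: in_stage_def; defauto].
Qed.

Ltac def_names := first
  [ apply is_name_def | apply name_over_def | apply is_hierarchy_def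
  | apply stage_def | apply in_stage_def | apply in_VA_def ].
Ltac def_more ::= first [ def_sets | def_names | def_algebra ].

Lemma ordinal_elt (xi zeta : V) : is_ordinal xi -> zeta ∈ xi -> is_ordinal zeta.
Proof. by move=> [tr tre] zx; split=> [|y yz]; apply: tre => //;
  apply: tr yz. Qed.

Lemma ordinal_succ (xi s : V) : is_ordinal xi ->
  (forall z, z ∈ s <-> z ∈ xi \/ z = xi) -> is_ordinal s.
Proof.
move=> [tr tre] hs; split; last by move=> y /hs[/tre|->].
move=> y z /hs[yx zy|-> zx]; apply/hs; left=> //; exact: tr zy.
Qed.

Lemma ordinal_union (W u : V) : (forall xi, xi ∈ W -> is_ordinal xi) ->
  (forall z, z ∈ u <-> exists2 y, y ∈ W & z ∈ y) -> is_ordinal u.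
Proof.
move=> hW hu; split=> [y z /hu[xi xW yx] zy|y /hu[xi /hW[_]]]; last exact.
by apply/hu; exists xi => //; have [tr _] := hW _ xW; apply: tr zy.
Qed.

Lemma hierarchyE f xi S x : is_hierarchy f -> maps f xi S ->
  x ∈ S <-> exists zeta T, [/\ zeta ∈ xi, maps f zeta T & name_over T x].
Proof.
move=> [_ _ hf] /hf ->;
  split=> [[fx rx [z [T [? ? ?]]]]|[z [T [? ? [[? ?] ?]]]]].
  by exists z, T; split.
by split=> //; exists z, T.
Qed.

Lemma hierarchy_dom f xi S zeta : is_hierarchy f -> maps f xi S -> zeta ∈ xi ->
  exists T, maps f zeta T.
Proof.
move=> [_ [al [tr _] hal] _] fx zx; apply/hal; apply: tr zx; apply/hal.
by exists S.
Qed.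

(** A stage is determined by the stages below, and a hierarchy that has a value at
  [xi] has values at all elements of [xi]: two hierarchies agree by induction. *)
Lemma stage_uniq xi S S' : stage xi S -> stage xi S' -> S = S'.
Proof.
move: xi S S'; apply: elt_ind; first by defauto.
suff le xi S S' : (forall zeta, zeta ∈ xi ->
      forall T T', stage zeta T -> stage zeta T' -> T = T') ->
    stage xi S -> stage xi S' -> forall x, x ∈ S -> x ∈ S'.
  move=> xi IH S S' hS hS'; apply: elt_ext => x; split.
    exact: le IH hS hS' x.
  exact: le IH hS' hS x.
move=> IH [f hf fS] [f' hf' fS'] x /(hierarchyE _ hf fS)[z [T [zx fT Tx]]].
apply/(hierarchyE _ hf' fS'); exists z, T; split=> //.
have [T' fT'] := hierarchy_dom hf' fS' zx.
by rewrite (IH z zx T T') //; [exists f|exists f'].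
Qed.

Lemma stage_maps f xi S zeta T : is_hierarchy f -> maps f xi S -> zeta ∈ xi ->
  stage zeta T -> maps f zeta T.
Proof.
move=> hf fS zx hT; have [T' fT'] := hierarchy_dom hf fS zx.
by rewrite (stage_uniq hT (S' := T')) //; exists f.
Qed.

Lemma dom_set (x : V) : exists D, forall y, y ∈ D <-> in_dom x y.
Proof.
have [U hU] := union_ex x; have [W hW] := union_ex U.
have [|D hD] := @separation V (in_dom x) W; first by defauto.
exists D => y; rewrite hD; split=> [[]|] //; move=> xy; split=> //.
have [b [p hp px]] := xy; apply/hW.
have [s hs] := pairing_ex y y; exists s; last by apply/hs; left.
by apply/hU; exists p => //; apply/hp; left.
Qed.

(** Such names are subsets of [T * A]. *)
Lemma names_over_set T : exists N, forall x, x ∈ N <-> name_over T x.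
Proof.
have [C hC] := carrier_in hA.
have [|F [_ hF]] := @relation_set V (fun _ _ => True) T C;
  first exact: def_prop.
have [Q hQ] := powerset_ex F.
have [|N hN] := @separation V (name_over T) Q; first by defauto.
exists N => x; rewrite hN; split=> [[]|hx] //; split=> //; apply/hQ => p px.
have [[[hp _] ran] dom] := hx; have [a [b pab]] := hp _ px.
have xab : maps x a b by exists p.
have [|q hq qF] := (hF a b).2; last by rewrite (opair_uniq pab hq).
by split=> //; [apply: dom; exists b|apply/hC/(ran a)].
Qed.

(** Given the stages below [xi], Replacement collects them, and the hierarchy on
  the successor of [xi] is their function extended by the value [S0] that the
  recursive clause prescribes at [xi]. *)
Lemma stage_ex xi : is_ordinal xi -> exists S, stage xi S.
Proof.
move: xi; apply: elt_ind; first by defauto.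
move=> xi IH oxi.
have [||E hE] := @replacement V stage xi; first by defauto.
  move=> z zx; have [S hS] := IH _ zx (ordinal_elt oxi zx).
  by exists S => // S' /stage_uniq; apply.
have [||W hW] :=
  @replacement V (fun T N => forall x, x ∈ N <-> name_over T x) E.
- by defauto.
- move=> T _; have [N hN] := names_over_set T; exists N => // N' hN'.
  by apply: elt_ext => x; rewrite hN hN'.
have [S0 hS0] := union_ex W.
have S0E x : x ∈ S0 <-> exists zeta T, [/\ zeta ∈ xi, stage zeta T & name_over T x].
  rewrite hS0; split=> [[N /hW[T /hE[z zx zT] hN] /hN Tx]|[z [T [zx zT Tx]]]].
    by exists z, T.
  have [N hN] := names_over_set T; exists N; last exact/hN.
  by apply/hW; exists T => //; apply/hE; exists z.
have [s hs] := add_element xi xi; have [E' hE'] := add_element E S0.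
have [|f [fp hf]] := @relation_set V
    (fun z S => z ∈ xi /\ stage z S \/ z = xi /\ S = S0) s E'; first by defauto.
have fE z S : maps f z S <-> z ∈ xi /\ stage z S \/ z = xi /\ S = S0.
  rewrite hf; split=> [[]|] // zS; split=> //.
    by apply/hs; case: zS => -[]; [left|right].
  by apply/hE'; case: zS => -[zx zS]; [left; apply/hE; exists z|right].
have f_below z T : z ∈ xi -> maps f z T <-> stage z T.
  move=> zx; rewrite fE; split=> [[[]|[zxi]]|] //; last by left.
  by case: (@elt_irrefl V xi); rewrite -{1}zxi.
have [tr _] := oxi.
exists S0, f; last by apply/fE; right.
split.
- split=> // z S S' /fE[[zx zS]|[-> ->]] /fE[[zx' zS']|[zxi' ->]] //.
  + exact: stage_uniq zS zS'.
  + by case: (@elt_irrefl V xi); rewrite -{1}zxi'.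
  + by case: (@elt_irrefl V xi).
- exists s; first exact: ordinal_succ hs.
  move=> z; rewrite hs; split=> [[S /fE[[]|[]]]|[zx|->]]; [by left|by right| |].
    by have [S hS] := IH _ zx (ordinal_elt oxi zx); exists S; apply/f_below.
  by exists S0; apply/fE; right.
move=> z S /fE zS x; suff -> : x ∈ S <->
    exists zeta T, [/\ zeta ∈ z, maps f zeta T & name_over T x].
  split=> [[t [T [? ? [[? ?] ?]]]]|[? ? [t [T [? ? ?]]]]]; first
    by split=> //; exists t, T.
  by exists t, T; split.
case: zS => [[zx [g hg gS]]|[-> ->]].
  rewrite (hierarchyE _ hg gS); split=> -[t [T [tz tT Tx]]]; exists t, T;
    split=> //.
    by apply/f_below; [apply: tr tz|exists g].
  apply: (stage_maps hg gS tz); apply/f_below => //; exact: tr tz.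
rewrite S0E; split=> -[t [T [tz tT Tx]]]; exists t, T; split=> //.
  exact/f_below.
exact/f_below.
Qed.

Lemma in_stageP xi S x : stage xi S -> in_stage xi x <-> x ∈ S.
Proof.
move=> hS; split=> [[f [T [hf fT xT]]]|xS]; first
  by rewrite (stage_uniq hS (S' := T)) //; exists f.
by have [f hf fS] := hS; exists f, S.
Qed.

(** The recursive clause freed from hierarchies. *)
Lemma in_stageE xi x : is_ordinal xi -> in_stage xi x <->
  is_name x /\ exists2 zeta, zeta ∈ xi & forall y, in_dom x y ->
    in_stage zeta y.
Proof.
move=> oxi; have [S hS] := stage_ex oxi; rewrite (in_stageP x hS).
have [f hf fS] := hS; rewrite (hierarchyE x hf fS); split.
  move=> [z [T [zx fT [nx Tx]]]]; split=> //; exists z => // y /Tx yT.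
  have hT : stage z T by exists f.
  exact/(in_stageP y hT).
move=> [nx [z zx hz]]; have [T fT] := hierarchy_dom hf fS zx.
have hT : stage z T by exists f.
by exists z, T; split=> //; split=> // y xy; apply/(in_stageP y hT)/hz.
Qed.

Lemma VA_dom x : in_VA x -> is_name x /\ forall y, in_dom x y -> in_VA y.
Proof.
move=> [xi oxi /(in_stageE _ oxi)[nx [z zx hz]]]; split=> // y /hz yz.
by exists z => //; apply: ordinal_elt zx.
Qed.

(** Collection bounds the stages of the elements of the domain.  The stages grow
  with the inclusion of ordinals, so the union of the collected ordinals is a
  common bound. *)
Lemma VA_intro x : is_name x -> (forall y, in_dom x y -> in_VA y) -> in_VA x.
Proof.
move=> nx hx; have [D hD] := dom_set x.
have [||W hW] := @collection V (fun y xi => is_ordinal xi /\ in_stage xi y) D.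
- by defauto.
- by move=> y /hD/hx[xi oxi hy]; exists xi.
have [|W' hW'] := @separation V (@is_ordinal V) W; first by defauto.
have [b hb] := union_ex W'.
have ob : is_ordinal b by apply: ordinal_union hb => xi /hW'[].
have [s hs] := add_element b b; exists s; first exact: ordinal_succ hs.
apply/in_stageE; first exact: ordinal_succ hs.
split=> //; exists b; first by apply/hs; right.
move=> y /hD/hW[xi xW [oxi /(in_stageE _ oxi)[ny [z zx hz]]]].
apply/in_stageE => //; split=> //; exists z => //; apply/hb; exists xi => //.
exact/hW'.
Qed.

(** An element [y] of the domain of [x] lies two levels below an element of [x],
  namely in the singleton belonging to some ordered pair; so the induction
  hypothesis is strengthened to elements of elements. *)
Lemma VA_ind (P : V -> Prop) : definable (fun r => P (r 0)) ->
  (forall x, in_VA x -> (forall y, in_dom x y -> P y) -> P x) ->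
  forall x, in_VA x -> P x.
Proof.
move=> dP hP x vx.
suff: (in_VA x -> P x) /\
      forall y, y ∈ x -> (in_VA y -> P y) /\ forall z, z ∈ y -> in_VA z -> P z.
  by case=> /(_ vx).
move: x {vx}; apply: elt_ind; first by defauto.
move=> x IH; split; last by move=> y /IH[hy h]; split=> // z /h[].
move=> vx; apply: hP => // y [b [p hp px]].
have [_ hx] := VA_dom vx; have vy : in_VA y by apply: hx; exists b, p.
have [s hs] := pairing_ex y y; have sp : s ∈ p by apply/hp; left.
by have [_ /(_ _ sp)[_]] := IH _ px; apply=> //; apply/hs; left.
Qed.

(** * Existence of the interpretation of membership and equality *)

Lemma dfunA_app1 (F : V -> A) s : definable_fun (fun r => code (F (r 0))) ->
  definable_fun s -> definable_fun (fun r => code (F (s r))).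
Proof.
move=> dF ds; apply: (@def_app2 _ (fun x a => x = code (F a))) => //.
  by defauto.
exact: (dfun_ren succn ds).
Qed.

Lemma dfunA_app2 (F : V -> V ->
  A) s t : definable_fun (fun r => code (F (r 0) (r 1))) ->
  definable_fun s -> definable_fun t ->
    definable_fun (fun r => code (F (s r) (t r))).
Proof.
move=> dF ds dt; apply: (@def_app3 _ (fun x a b => x = code (F a b))) => //.
- by defauto.
- exact: (dfun_ren succn ds).
- exact: (dfun_ren succn dt).
Qed.

Lemma dfunA_app3 (F : V -> V -> V -> A) s t u :
  definable_fun (fun r => code (F (r 0) (r 1) (r 2))) ->
  definable_fun s -> definable_fun t -> definable_fun u ->
    definable_fun (fun r => code (F (s r) (t r) (u r))).
Proof.
move=> dF ds dt du.
apply: (@def_app4 _ (fun x a b c => x = code (F a b c))) => //.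
- by defauto.
- exact: (dfun_ren succn ds).
- exact: (dfun_ren succn dt).
- exact: (dfun_ren succn du).
Qed.

(** The truth values of the bounded quantifiers: an element [x] of the domain of
  [v] counts as a member of [v] to the extent [v(x)]. *)
Definition sup_over (v : V) (g : V -> A) : A :=
  Sup [set b | exists x p, maps v x (code p) /\ b = p `&` g x].
Definition inf_over (v : V) (g : V -> A) : A :=
  Inf [set b | exists x p, maps v x (code p) /\ b = bimp p (g x)].

Lemma dfun_sup_over (s : env -> V) (G : V -> env -> A) : definable_fun s ->
  definable_fun (fun r => code (G (r 0) (fun n => r n.+1))) ->
  definable_fun (fun r => code (sup_over (s r) (fun x => G x r))).
Proof.
move=> ds dG; rewrite /sup_over; apply: dfun_Sup; apply: def_ex; apply: def_exA.
have h := dfun_ren (fun n => if n is m.+1 then m.+3 else 1) dG.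
by apply: def_and; [have h' := dfun_ren (addn 3) ds|]; defauto.
Qed.

Lemma dfun_inf_over (s : env -> V) (G : V -> env -> A) : definable_fun s ->
  definable_fun (fun r => code (G (r 0) (fun n => r n.+1))) ->
  definable_fun (fun r => code (inf_over (s r) (fun x => G x r))).
Proof.
move=> ds dG; rewrite /inf_over; apply: dfun_Inf; apply: def_ex; apply: def_exA.
have h := dfun_ren (fun n => if n is m.+1 then m.+3 else 1) dG.
by apply: def_and; [have h' := dfun_ren (addn 3) ds|]; defauto.
Qed.

Ltac dfun_apply := match goal with
  | H : definable_fun (fun r => code (?F (r 0))) |- definable_fun (fun r => code (?F _)) =>
      apply (dfunA_app1 H)
  | H : definable_fun (fun r => code (?F (r 0) (r 1))) |-
      definable_fun (fun r => code (?F _ _)) => apply (dfunA_app2 H)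
  | H : definable_fun (fun r => code (?F (r 0) (r 1) (r 2))) |-
      definable_fun (fun r => code (?F _ _ _)) => apply (dfunA_app3 H)
  end.
Ltac dfun_more ::= first
  [ dfun_apply | apply dfun_sup_over | apply dfun_inf_over | dfun_algebra ].

Definition defV (g : V -> A) := definable_fun (fun r => code (g (r 0))).

Lemma sup_over_le v g c : defV g ->
  sup_over v g <= c <-> forall x p, maps v x (code p) -> p `&` g x <= c.
Proof.
rewrite /defV => dg; rewrite Sup_le; last by rewrite /defA /mkset; defauto.
split=> [h x p vx|h _ [x [p [vx ->]]]]; last exact: h.
by apply: h; exists x, p.
Qed.

Lemma le_inf_over v g c : defV g ->
  c <= inf_over v g <-> forall x p, maps v x (code p) -> c `&` p <= g x.
Proof.
rewrite /defV => dg; rewrite le_Inf; last by rewrite /defA /mkset; defauto.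
split=> [h x p vx|h _ [x [p [vx ->]]]]; last by rewrite le_bimp; apply: h.
by rewrite -le_bimp; apply: h; exists x, p.
Qed.

Lemma maps_dom (v x y : V) : maps v x y -> in_dom v x.
Proof. by exists y. Qed.

Lemma eq_sup_over v g g' : (forall x, in_dom v x -> g x = g' x) ->
  sup_over v g = sup_over v g'.
Proof.
move=> gg'; congr supremum; apply/predeqP => b; split=> -[x [p [vx ->]]];
  by exists x, p; rewrite gg' //; apply: maps_dom vx.
Qed.

Lemma eq_inf_over v g g' : (forall x, in_dom v x -> g x = g' x) ->
  inf_over v g = inf_over v g'.
Proof.
move=> gg'; congr infimum; apply/predeqP => b; split=> -[x [p [vx ->]]];
  by exists x, p; rewrite gg' //; apply: maps_dom vx.
Qed.

(** The recursion for [‖u ≈ v‖], with [‖x ∈ v‖] expanded, and arranged so that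
  the value at [(u, v)] only depends on values at pairs in [dom u * dom v]:
  approximate solutions can then live on rectangles, and induction on the first
  argument suffices.  That it agrees with the intended recursion follows from
  the symmetry of the solution. *)
Definition eq_step (e : V -> V -> A) (u v : V) : A :=
  inf_over u (fun x => sup_over v (fun y => e x y)) `&`
  inf_over v (fun y => sup_over u (fun x => e x y)).

Lemma eq_eq_step e e' u v :
  (forall x y, in_dom u x -> in_dom v y -> e x y = e' x y) ->
  eq_step e u v = eq_step e' u v.
Proof.
move=> h; congr (_ `&` _); apply: eq_inf_over => x ux;
  apply: eq_sup_over => y vy;
  exact: h.
Qed.

(** The value at [(u, v)] of a set [f] read as a function of two arguments into [A].
  The uniqueness clause makes it definable for every set [f], functional or
  not. *)
Definition value_at (f u v : V) : A :=
  xget \bot [set a | maps2 f u v (code a) /\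
                     forall b, maps2 f u v (code b) -> b = a].

Lemma value_at_dfun s t u : definable_fun s -> definable_fun t ->
  definable_fun u ->
  definable_fun (fun r => code (value_at (s r) (t r) (u r))).
Proof.
apply: dfunA_app3; apply: dfun_xget; last by defauto.
by move=> r a b [_ ha] [/ha].
Qed.

(** Sets of names on which the recursion for equality can be restricted. *)
Definition dom_closed (D : V) : Prop :=
  (forall u, u ∈ D -> in_VA u) /\
  (forall u x, u ∈ D -> in_dom u x -> x ∈ D).

Definition eq_solution (D1 D2 f : V) : Prop :=
  [/\ dom_closed D1, dom_closed D2 & forall u v, u ∈ D1 -> v ∈ D2 ->
      value_at f u v = eq_step (value_at f) u v].

(** The union of all partial solutions. *)
Definition eq_value (u v : V) (a : A) : Prop := exists D1 D2 f,
  [/\ eq_solution D1 D2 f, u ∈ D1, v ∈ D2 & a = value_at f u v].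

Lemma eq_value_def s t (a : env -> A) : definable_fun s -> definable_fun t ->
  definable_fun (fun r => code (a r)) ->
    definable (fun r => eq_value (s r) (t r) (a r)).
Proof.
move=> ds dt da; apply: (@def_ext _ (fun r =>
    (fun x y z => eq_value x y (decode z)) (s r) (t r) (code (a r)))).
  by move=> r; rewrite codeK.
have value_at_d : definable_fun (fun r : env => code (value_at (r 0) (r 1) (r 2))).
  by apply: value_at_dfun; defauto.
apply: (def_app3 (F := fun x y z => eq_value x y (decode z))) => //.
by rewrite /eq_value /eq_solution /dom_closed /eq_step; defauto.
Qed.

Ltac def_more ::= first
  [ def_sets | def_names | apply eq_value_def | def_algebra ].

(** Two solutions satisfy the same recursion on the intersection of their
  rectangles, which is again closed under domains. *)
Lemma eq_value_uniq u v a b : in_VA u -> eq_value u v a -> eq_value u v b ->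
  a = b.
Proof.
move=> vu; move: u vu v a b; apply: VA_ind; first by defauto.
move=> u vu IH v a b [D1 [D2 [f [sf uD vD ->]]]] [D1' [D2' [f' [sf' uD' vD' ->]]]].
have [[_ c1] [_ c2] ef] := sf; have [[_ c1'] [_ c2'] ef'] := sf'.
rewrite ef // ef' //; apply: eq_eq_step => x y ux vy.
apply: (IH x ux y).
  by exists D1, D2, f; split=> //; [exact: c1 ux|exact: c2 vy].
by exists D1', D2', f'; split=> //; [exact: c1' ux|exact: c2' vy].
Qed.

Definition eqv (u v : V) : A := xget \bot [set a | in_VA u /\ eq_value u v a].
Definition memv (u v : V) : A := sup_over v (fun x => eqv x u).

Lemma eqv_dfun s t : definable_fun s -> definable_fun t ->
  definable_fun (fun r => code (eqv (s r) (t r))).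
Proof.
apply: dfunA_app2; apply: dfun_xget; last by defauto.
by move=> r a b [vu ha] [_ hb]; apply: eq_value_uniq ha hb.
Qed.

Lemma memv_dfun s t : definable_fun s -> definable_fun t ->
  definable_fun (fun r => code (memv (s r) (t r))).
Proof.
apply: dfunA_app2; rewrite /memv; apply: dfun_sup_over; first by defauto.
by apply: eqv_dfun; defauto.
Qed.

Ltac dfun_more ::= first
  [ dfun_apply | apply eqv_dfun | apply memv_dfun
  | apply dfun_sup_over | apply dfun_inf_over | dfun_algebra ].

Lemma stage_closed xi S : is_ordinal xi -> stage xi S -> dom_closed S.
Proof.
move=> oxi hS; split=> u; first by move/(in_stageP _ hS) => uS; exists xi.
move=> x /(in_stageP _ hS)/(in_stageE _ oxi)[nu [z zx hz]] /hz.
have oz := ordinal_elt oxi zx.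
move/(in_stageE _ oz) => [nx [z' z'z hz']].
apply/(in_stageP _ hS)/(in_stageE _ oxi); split=> //; exists z' => //.
by have [tr _] := oxi; apply: tr z'z.
Qed.

Lemma VA_closed u : in_VA u -> exists2 D, dom_closed D & u ∈ D.
Proof.
move=> [xi oxi uxi]; have [S hS] := stage_ex oxi; exists S.
  exact: stage_closed hS.
exact/(in_stageP _ hS).
Qed.

Lemma graph_set (e : V -> V -> A) D1 D2 :
  definable_fun (fun r => code (e (r 0) (r 1))) ->
  exists f, is_function f /\ forall u v z, u ∈ D1 -> v ∈ D2 ->
    maps2 f u v z <-> z = code (e u v).
Proof.
move=> de; have [C hC] := carrier_in hA.
have [|Q [_ hQ]] := @relation_set V (fun _ _ => True) D1 D2;
  first exact: def_prop.
have [|f [fp hf]] := @relation_set V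
    (fun p z => exists u v, is_opair p u v /\ z = code (e u v)) Q C.
  by defauto.
exists f; split.
  split=> // p z z' /hf[_ _ [u [v [hp ->]]]] /hf[_ _ [u' [v' [hp' ->]]]].
  by have [-> ->] := opair_inj hp hp'.
move=> u v z uD vD; split=> [[p hp /hf[_ _ [u' [v' [hp' ->]]]]]|->].
  by have [-> ->] := opair_inj hp hp'.
have [|p hp pQ] := (hQ u v).2; first by [].
exists p => //; apply/hf; split=> //; last by exists u, v.
by apply/hC; exists (e u v).
Qed.

Lemma value_atE f u v a : is_function f -> maps2 f u v (code a) ->
  value_at f u v = a.
Proof.
move=> [_ ff] fa.
have uniq b : maps2 f u v (code b) -> b = a.
  move: fa => [p hp pa] [q hq qb]; rewrite (opair_uniq hq hp) in qb.
  exact/(code_inj hA)/(ff _ _ _ qb pa).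
by apply: xget_unique => [|b [/uniq]].
Qed.

Lemma eq_solution_eqv D1 D2 f u v : eq_solution D1 D2 f -> u ∈ D1 -> v ∈ D2 ->
  eqv u v = value_at f u v.
Proof.
move=> sf uD vD; have [[vD1 _] _ _] := sf; have vu := vD1 _ uD.
have h : eq_value u v (value_at f u v) by exists D1, D2, f.
by apply: xget_unique => // b [_ /(eq_value_uniq vu)]; apply.
Qed.

Lemma eq_value_step u v a : eq_value u v a -> eqv u v = eq_step eqv u v.
Proof.
move=> [D1 [D2 [f [sf uD vD _]]]]; have [[_ c1] [_ c2] ef] := sf.
rewrite (eq_solution_eqv sf) // ef //; apply: eq_eq_step => x y ux vy.
by rewrite (eq_solution_eqv sf) //; [exact: c1 ux|exact: c2 vy].
Qed.

(** By induction on the stage [S] of [u], with a fixed set [D] around [v]: the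
  previous stages already carry total values, and [eq_step] computed from them is
  a solution on [S * D]. *)
Lemma eq_value_ex u v : in_VA u -> in_VA v -> exists a, eq_value u v a.
Proof.
move=> [xi]; move: xi u v.
suff h xi : is_ordinal xi -> forall u v, in_stage xi u -> in_VA v ->
    exists a, eq_value u v a.
  by move=> xi u v oxi; apply: h.
move: xi; apply: elt_ind; first by defauto.
move=> xi IH oxi u v ux vv; have [S hS] := stage_ex oxi.
have cS := stage_closed oxi hS; have [D cD vD] := VA_closed vv.
have [|f [ff hf]] := @graph_set (eq_step eqv) S D.
  by rewrite /eq_step; defauto.
have fE x y : x ∈ S -> y ∈ D -> value_at f x y = eq_step eqv x y.
  by move=> xS yD; apply: value_atE => //; apply/hf.
exists (value_at f u v), S, D, f; split=> //; last exact/(in_stageP _ hS).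
split=> // x y xS yD; rewrite fE //; apply: eq_eq_step => x' y' xx' yy'.
have x'S : x' ∈ S by have [_ h] := cS; apply: h xx'.
have y'D : y' ∈ D by have [_ h] := cD; apply: h yy'.
rewrite fE //.
have [_ [z zx /(_ _ xx') zx']] := (in_stageE _ oxi).1 ((in_stageP _ hS).2 xS).
have [vD' _] := cD.
have [a ha] := IH _ zx (ordinal_elt oxi zx) _ _ zx' (vD' _ y'D).
exact: eq_value_step ha.
Qed.

Lemma eqv_step u v : in_VA u -> in_VA v -> eqv u v = eq_step eqv u v.
Proof. by move=> vu vv; have [a] := eq_value_ex vu vv;
  apply: eq_value_step. Qed.

Lemma eqv_sym u v : in_VA u -> in_VA v -> eqv u v = eqv v u.
Proof.
move=> vu; move: u vu v.
apply: VA_ind; first by defauto.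
move=> u vu IH v vv; rewrite !eqv_step // /eq_step meetC.
have [_ vvd] := VA_dom vv.
congr (_ `&` _); apply: eq_inf_over => x hx; apply: eq_sup_over => y hy.
  exact: (IH y hy x (vvd x hx)).
exact: (IH x hx y (vvd y hy)).
Qed.

(** By symmetry, this is the intended recursion. *)
Lemma eqvE u v : in_VA u -> in_VA v ->
  eqv u v = inf_over u (fun x => memv x v) `&` inf_over v (fun x => memv x u).
Proof.
move=> vu vv; have [_ vud] := VA_dom vu; have [_ vvd] := VA_dom vv.
rewrite (eqv_step vu vv) /eq_step; congr (_ `&` _).
apply: eq_inf_over => x ux; apply: eq_sup_over => y vy.
exact: (eqv_sym (vud x ux) (vvd y vy)).
Qed.

Lemma Sup_maps2 f v u g : 
  (forall x, in_dom v x -> forall q, maps2 f x u (code q) <-> q = g x) ->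
  Sup [set b | exists x p q, [/\ maps v x (code p),
        maps2 f x u (code q) & b = p `&` q]] = sup_over v g.
Proof.
move=> hf; congr supremum; apply/predeqP => b; split.
  by move=> [x [p [q [vx /hf -> //]]]]; [exists x, p|apply: maps_dom vx].
by move=> [x [p [vx ->]]]; exists x, p, (g x); split=> //; apply/hf => //;
  apply: maps_dom vx.
Qed.

Lemma Inf_maps2 f v u g : 
  (forall x, in_dom v x -> forall q, maps2 f x u (code q) <-> q = g x) ->
  Inf [set b | exists x p q, [/\ maps v x (code p),
        maps2 f x u (code q) & b = bimp p q]] = inf_over v g.
Proof.
move=> hf; congr infimum; apply/predeqP => b; split.
  by move=> [x [p [q [vx /hf -> //]]]]; [exists x, p|apply: maps_dom vx].
by move=> [x [p [vx ->]]]; exists x, p, (g x); split=> //; apply/hf => //;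
  apply: maps_dom vx.
Qed.

Lemma maps2_code f u v a : is_function f -> maps2 f u v (code a) ->
  forall q, maps2 f u v (code q) <-> q = a.
Proof.
move=> ff fa q; split=> [fq|->] //.
by rewrite -(value_atE ff fa) (value_atE ff fq).
Qed.

(** The clauses for [ee u v] and [ee v u] only use [mm] at pairs made of an element
  of a domain and [u] or [v], hence [ee] at pairs having a component in the domain
  of [u]; so one induction on [u] determines both. *)
Lemma interpretation_values (D mm ee : V) : is_interpretation code D mm ee ->
  forall u v, u ∈ D -> v ∈ D ->
    maps2 ee u v (code (eqv u v)) /\ maps2 mm u v (code (memv u v)).
Proof.
move=> [vD cD fm fe hI].
have mmE u v : u ∈ D -> v ∈ D ->
    (forall x, in_dom v x -> maps2 ee x u (code (eqv x u))) ->
    maps2 mm u v (code (memv u v)).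
  move=> uD vD' hx; have [] := hI u v uD vD'; rewrite (Sup_maps2 (g :=
    eqv^~ u)) //.
  by move=> x /hx; apply: maps2_code.
suff eeE u : in_VA u -> u ∈ D -> forall v, v ∈ D ->
    maps2 ee u v (code (eqv u v)) /\ maps2 ee v u (code (eqv v u)).
  move=> u v uD vD'; split; first by have [] := eeE u (vD _ uD) uD v vD'.
  apply: mmE => // x vx; have xD := cD _ _ vD' vx.
  by have [] := eeE x (vD _ xD) xD u uD.
move: u; apply: VA_ind; first by defauto.
move=> u vu IH uD v vD'; have [_ hud] := VA_dom vu.
have mxv x : in_dom u x -> forall q, maps2 mm x v (code q) <-> q = memv x v.
  move=> ux; have xD := cD _ _ uD ux; apply: maps2_code => //;
    apply: mmE => // y vy.
  by have [] := IH x ux xD y (cD _ _ vD' vy).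
have mxu x : in_dom v x -> forall q, maps2 mm x u (code q) <-> q = memv x u.
  move=> vx; have xD := cD _ _ vD' vx; apply: maps2_code => //;
    apply: mmE => // y uy.
  by have [] := IH y uy (cD _ _ uD uy) x xD.
have [_ euv] := hI u v uD vD'; have [_ evu] := hI v u vD' uD; have vv :=
  vD _ vD'.
rewrite (Inf_maps2 mxv) (Inf_maps2 mxu) -eqvE // in euv.
by rewrite (Inf_maps2 mxv) (Inf_maps2 mxu) -eqvE // in evu.
Qed.

Lemma interpretation_ex u v : in_VA u -> in_VA v ->
  exists D mm ee, [/\ is_interpretation code D mm ee, u ∈ D & v ∈ D].
Proof.
move=> vu vv; have [D1 [v1 c1] uD1] := VA_closed vu.
have [D2 [v2 c2] vD2] := VA_closed vv; have [D hD] := binary_union D1 D2.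
have [|ee [fe he]] := @graph_set eqv D D; first by defauto.
have [|mm [fm hm]] := @graph_set memv D D; first by defauto.
have cD x y : x ∈ D -> in_dom x y -> y ∈ D.
  by move=> /hD[] h xy; apply/hD; [left; apply: c1 xy|right; apply: c2 xy].
have vD x : x ∈ D -> in_VA x by move=> /hD[/v1|/v2].
exists D, mm, ee; split; [|by apply/hD; left|by apply/hD; right].
have eeE x y : x ∈ D -> y ∈ D -> maps2 ee x y (code (eqv x y)).
  by move=> xD yD; apply/he.
have mmE x y : x ∈ D -> y ∈ D -> maps2 mm x y (code (memv x y)).
  by move=> xD yD; apply/hm.
split=> // x y xD yD; split.
  rewrite (Sup_maps2 (g := eqv^~ x)); first exact: mmE.
  by move=> z yz; apply: maps2_code => //; apply: eeE => //; apply: cD yz.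
rewrite (Inf_maps2 (g := memv^~ y)); last first.
  by move=> z xz; apply: maps2_code => //; apply: mmE => //; apply: cD xz.
rewrite (Inf_maps2 (g := memv^~ x)); last first.
  by move=> z yz; apply: maps2_code => //; apply: mmE => //; apply: cD yz.
by rewrite -eqvE; [apply: eeE|apply: vD|apply: vD].
Qed.

Lemma value_eqE u v : in_VA u -> in_VA v -> val_eq code u v = eqv u v.
Proof.
move=> vu vv; have [D [mm [ee [hI uD vD]]]] := interpretation_ex vu vv.
apply: xget_unique => [|b [D' [mm' [ee' [hI' uD' vD' hb]]]]].
  exists D, mm, ee; split=> //.
  by have [] := interpretation_values hI uD vD.
have [h _] := interpretation_values hI' uD' vD'.
by have [_ _ _ fe _] := hI'; apply: (maps2_code fe h _).1.
Qed.

Lemma value_inE u v : in_VA u -> in_VA v -> val_in code u v = memv u v.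
Proof.
move=> vu vv; have [D [mm [ee [hI uD vD]]]] := interpretation_ex vu vv.
apply: xget_unique => [|b [D' [mm' [ee' [hI' uD' vD' hb]]]]].
  exists D, mm, ee; split=> //.
  by have [] := interpretation_values hI uD vD.
have [_ h] := interpretation_values hI' uD' vD'.
by have [_ _ fm _ _] := hI'; apply: (maps2_code fm h _).1.
Qed.

(** * Equality and membership *)

Lemma mem_intro u v x p c : maps v x (code p) -> c <= p -> c <= eqv x u ->
  c <= memv u v.
Proof.
move=> vx cp cx; have dg : defV (eqv^~ u) by rewrite /defV; defauto.
apply: le_trans ((sup_over_le v _ dg).1 (lexx _) x p vx).
by rewrite lexI cp.
Qed.

(** Infinite distributivity, in the form of an elimination rule: to deduce [e] from
  [‖u ∈ v‖], one may choose an element [x] of the domain of [v], at the price of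
  shrinking the condition.  It holds because the meet has a right adjoint. *)
Lemma mem_elim u v c e : c <= memv u v ->
  (forall x p b, maps v x (code p) -> b <= c -> b <= p -> b <= eqv x u ->
    b <= e) ->
  c <= e.
Proof.
move=> cm h; have dg : defV (eqv^~ u) by rewrite /defV; defauto.
rewrite -[c]meetxx -le_bimp; apply: le_trans cm _.
apply/(sup_over_le _ _ dg) => x p vx; rewrite le_bimp; apply: (h _ _ _ vx).
- by rewrite leIr.
- by rewrite leIxl // leIl.
- by rewrite leIxl // leIr.
Qed.

Lemma eq_elim u v x p c : in_VA u -> in_VA v -> c <= eqv u v ->
  maps u x (code p) -> c <= p -> c <= memv x v.
Proof.
move=> vu vv; rewrite eqvE // lexI => /andP[ce _] ux cp.
have dg : defV (memv^~ v) by rewrite /defV; defauto.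
by apply: le_trans ((le_inf_over _ _ dg).1 ce x p ux); rewrite lexI lexx.
Qed.

Lemma eq_intro u v c : in_VA u -> in_VA v ->
  (forall x p b, maps u x (code p) -> b <= c -> b <= p -> b <= memv x v) ->
  (forall x p b, maps v x (code p) -> b <= c -> b <= p -> b <= memv x u) ->
  c <= eqv u v.
Proof.
move=> vu vv hu hv; rewrite eqvE // lexI; apply/andP; split.
  apply/le_inf_over; first by rewrite /defV; defauto.
  by move=> x p ux; apply: (hu _ _ _ ux); rewrite ?leIl ?leIr.
apply/le_inf_over; first by rewrite /defV; defauto.
by move=> x p vx; apply: (hv _ _ _ vx); rewrite ?leIl ?leIr.
Qed.

Lemma eqv_symm u v c : in_VA u -> in_VA v -> c <= eqv u v -> c <= eqv v u.
Proof. by move=> vu vv; rewrite eqv_sym. Qed.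

Lemma eqv_refl u c : in_VA u -> c <= eqv u u.
Proof.
move=> vu; apply: (@le_trans _ _ \top); first exact: lex1.
move: u vu; apply: VA_ind; first by defauto.
move=> u vu IH; apply: eq_intro => // x p b ux _ bp; apply: (mem_intro ux bp);
  apply: le_trans (IH x (maps_dom ux)); exact: lex1.
Qed.

Lemma mem_dom u x p c : in_VA u -> maps u x (code p) -> c <= p -> c <= memv x u.
Proof.
move=> vu ux cp; apply: (mem_intro ux cp); apply: eqv_refl.
by have [_] := VA_dom vu; apply; exact: maps_dom ux.
Qed.

(** By induction on the middle name: members of [u] are equal to members of [v],
  which are equal to members of [w], and transitivity is used through an element
  of the domain of [v]. *)
Lemma eqv_trans v u w c : in_VA v -> in_VA u -> in_VA w ->
  c <= eqv u v -> c <= eqv v w -> c <= eqv u w.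
Proof.
move=> vv; move: v vv u w c; apply: VA_ind; first by defauto.
move=> v vv IH.
have half u w x p b : in_VA u -> in_VA w -> b <= eqv u v -> b <= eqv v w ->
    maps u x (code p) -> b <= p -> b <= memv x w.
  move=> vu vw buv bvw ux bp; have [_ hu] := VA_dom vu.
  have vx : in_VA x by apply: hu; exact: maps_dom ux.
  apply: (mem_elim (eq_elim vu vv buv ux bp)) => y q b' vy b'b b'q b'yx.
  have [_ hv] := VA_dom vv; have vy' := hv _ (maps_dom vy).
  have b'yw := eq_elim vv vw (le_trans b'b bvw) vy b'q.
  apply: (mem_elim b'yw) => z s b'' wz b''b' b''s b''zy.
  apply: (mem_intro wz b''s); have [_ hw] := VA_dom vw.
  apply: (IH y (maps_dom vy)) => //; first by apply: hw; exact: maps_dom wz.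
  exact: le_trans b''b' b'yx.
move=> u w c vu vw cuv cvw; apply: eq_intro => // x p b hx bc bp.
  by apply: (half _ _ _ _ _ _ _ _ _ hx bp) => //; apply: le_trans bc _.
apply: (half _ _ _ _ _ _ _ _ _ hx bp) => //; apply: le_trans bc _;
  exact: eqv_symm.
Qed.

Lemma mem_eql u v w c : in_VA u -> in_VA v -> in_VA w ->
  c <= eqv u v -> c <= memv u w -> c <= memv v w.
Proof.
move=> vu vv vw cuv cuw; apply: (mem_elim cuw) => x p b wx bc bp bxu.
apply: (mem_intro wx bp); have [_ hw] := VA_dom vw.
apply: (eqv_trans (v := u)) => //; first by apply: hw; exact: maps_dom wx.
exact: le_trans bc cuv.
Qed.

Lemma mem_eqr u v w c : in_VA u -> in_VA v -> in_VA w ->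
  c <= eqv u v -> c <= memv w u -> c <= memv w v.
Proof.
move=> vu vv vw cuv cwu; apply: (mem_elim cwu) => x p b ux bc bp bxw.
have [_ hu] := VA_dom vu.
apply: (mem_eql (u := x)) => //; first by apply: hu; exact: maps_dom ux.
by apply: (eq_elim _ _ _ ux bp) => //; apply: le_trans bc cuv.
Qed.

(** * Truth values of formulas *)

Local Notation VA := (VA code).
Local Notation value := (@value V d A code).
Implicit Types (p q : formula VA).

Lemma value_rename p : forall f r,
  value r (rename f p) = value (fun n => r (f n)) p.
Proof.
elim: p => //= [t s|t s|p IHp q IHq|p IHp q IHq|p IHp q IHq|p IHp|p IHp|p IHp]
  f r; rewrite ?eval_rename_term ?IHp ?IHq //;
    first [congr supremum|congr infimum];
  by apply/predeqP => b; split=> -[u ->]; exists u; rewrite IHp scons_up_ren.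
Qed.

Definition eval_name (r : env) (t : term VA) : V :=
  match t with Var n => r n | Cst c => sval c end.

Lemma eval_name_dfun t : definable_fun (eval_name^~ t).
Proof. by case: t => [n|c]; [apply: dfun_var|apply: dfun_cst]. Qed.

Lemma eval_nameE (r : nat ->
  VA) t : eval_name (fun n => sval (r n)) t = sval (eval_term r t).
Proof. by case: t. Qed.

(** This makes the schemas of the model applicable to truth values, and ensures that
  the suprema and infima interpreting the quantifiers exist. *)
Lemma value_dfun p : exists2 t : env -> A, definable_fun (fun r => code (t r)) &
  forall r : nat -> VA, value r p = t (fun n => sval (r n)).
Proof.
have quant (t : env -> A) : definable_fun (fun r => code (t r)) ->
    definable (fun r => exists x, in_VA x /\
      decode (r 0) = t (scons x (fun n => r n.+1))).
  move=> dt; apply: def_ex; apply: def_and; first by defauto.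
  apply: def_eqA; first by defauto.
  apply: (@def_ext _ (fun r => r 0 = 
    code (t (fun n => r (if n is m.+1 then m.+2 else 0).+1)))); last first.
    exact: (dfun_ren (fun n => if n is m.+1 then m.+2 else 0) dt).
  move=> r; suff -> : scons (r 1) (fun n => r n.+3) =
     (fun n => r (if n is m.+1 then m.+2 else 0).+1) by [].
  by apply/funext => -[].
have scons_sval (u : VA) r : (fun n => sval (scons u r n)) = scons (sval u) (fun n => sval (r n)).
  by apply/funext => -[].
elim: p => [|t s|t s|p [f df hf] q [g dg hg]|p [f df hf] q [g dg hg]
  |p [f df hf] q [g dg hg]|p [f df hf]|p [f df hf]|p [f df hf]].
- by exists (fun=> \bot) => //; apply: dfun_cst.
- exists (fun r => memv (eval_name r t) (eval_name r s)).
    by apply: memv_dfun; apply: eval_name_dfun.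
  by move=> r; rewrite !eval_nameE /= value_inE //; apply: svalP.
- exists (fun r => eqv (eval_name r t) (eval_name r s)).
    by apply: eqv_dfun; apply: eval_name_dfun.
  by move=> r; rewrite !eval_nameE /= value_eqE //; apply: svalP.
- by exists (fun r => bimp (f r) (g r)); [apply: dfun_bimp|move=> r /=;
    rewrite hf hg].
- by exists (fun r => f r `&` g r); [apply: dfun_meet|move=> r /=;
    rewrite hf hg].
- by exists (fun r => f r `|` g r); [apply: dfun_join|move=> r /=;
    rewrite hf hg].
- by exists (fun r => ~` (f r)); [apply: dfun_compl|move=> r /=; rewrite hf].
- exists (fun r => Sup [set b | exists x, in_VA x /\ b = f (scons x r)]).
    exact/dfun_Sup/quant.
  move=> r /=; congr supremum; apply/predeqP => b; split=> [[u ->]|[x [vx ->]]].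
    by exists (sval u); rewrite hf scons_sval; split=> //; apply: svalP.
  by exists (exist _ x vx); rewrite hf scons_sval.
- exists (fun r => Inf [set b | exists x, in_VA x /\ b = f (scons x r)]).
    exact/dfun_Inf/quant.
  move=> r /=; congr infimum; apply/predeqP => b; split=> [[u ->]|[x [vx ->]]].
    by exists (sval u); rewrite hf scons_sval; split=> //; apply: svalP.
  by exists (exist _ x vx); rewrite hf scons_sval.
Qed.


Lemma def_value1 p (r : nat -> VA) : exists2 g : V -> A, defV g &
  forall u : VA, value (scons u r) p = g (sval u).
Proof.
have [t dt ht] := value_dfun p.
exists (fun x => t (scons x (fun n => sval (r n)))).
  (* index 0 is the value of the graph, 1 its argument, the others are [r] *)
  rewrite /defV; have := def_subst (fun n =>
    if n is m.+1 then if m is k.+1 then Cst (sval (r k)) else Var 1 else Var 0) dt.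
  apply: def_ext => rho; set f := (X in t X); set g :=
    (X in _ <-> _ = code (t X)).
  by have -> : f = g by apply/funext => -[].
by move=> u; rewrite ht; congr t; apply/funext => -[].
Qed.

Lemma def_value2 p (r : nat -> VA) : exists2 g : V -> V -> A,
  definable_fun (fun r => code (g (r 0) (r 1))) &
  forall u v : VA, value (scons u (scons v r)) p = g (sval u) (sval v).
Proof.
have [t dt ht] := value_dfun p.
exists (fun x y => t (scons x (scons y (fun n => sval (r n))))).
  have := def_subst (fun n => if n is m.+1 then
    if m is k.+2 then Cst (sval (r k)) else Var m.+1 else Var 0) dt.
  apply: def_ext => rho; set f := (X in t X); set g :=
    (X in _ <-> _ = code (t X)).
  by have -> : f = g by apply/funext => -[|[]].
by move=> u v; rewrite ht; congr t; apply/funext => -[|[]].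
Qed.

Lemma values_defA p (r : nat -> VA) :
  defA [set b | exists u : VA, b = value (scons u r) p].
Proof.
have [g dg hg] := def_value1 p r; rewrite /defV in dg.
rewrite /defA /=; apply: (@def_ext _ (fun r => exists x, in_VA x /\
  decode (r 0) = g x)).
  move=> rho; split=> [[x [vx ->]]|[u ->]]; last by exists (sval u); split;
    [apply: svalP|rewrite hg].
  by exists (exist _ x vx); rewrite hg.
by defauto.
Qed.

Lemma value_all c p (r : nat -> VA) :
  c <= value r (FAll p) <-> forall u : VA, c <= value (scons u r) p.
Proof.
rewrite /= le_Inf; last exact: values_defA.
by split=> [h u|h b [u ->]] //; apply: h; exists u.
Qed.

Lemma value_ex_intro c p (r : nat -> VA) (u : VA) :
  c <= value (scons u r) p -> c <= value r (FEx p).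
Proof.
move=> h; apply: (le_trans h); apply: ((Sup_le _ (values_defA p r)).1 (lexx _)).
by exists u.
Qed.

Lemma value_ex_elim c e p (r : nat -> VA) : c <= value r (FEx p) ->
  (forall (u : VA) b, b <= c -> b <= value (scons u r) p -> b <= e) -> c <= e.
Proof.
move=> h hu; rewrite -[c]meetxx -le_bimp; apply: (le_trans h).
apply/(Sup_le _ (values_defA p r)) => b [u ->]; rewrite le_bimp.
by apply: (hu u); [apply: leIr|apply: leIl].
Qed.

Lemma value_imp c p q (r : nat -> VA) : c <= value r (FImp p q) <->
  forall b, b <= c -> b <= value r p -> b <= value r q.
Proof.
rewrite /= le_bimp; split=> [h b bc bp|h]; last first.
  by apply: h; [apply: leIl|apply: leIr].
by apply: le_trans h; rewrite lexI bc.
Qed.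

Lemma value_and c p q (r : nat -> VA) : c <= value r (FAnd p q) <->
  c <= value r p /\ c <= value r q.
Proof. by rewrite /= lexI; split=> /andP. Qed.

Lemma value_or_elim c e p q (r : nat -> VA) : c <= value r (FOr p q) ->
  (forall b, b <= c -> b <= value r p -> b <= e) ->
  (forall b, b <= c -> b <= value r q -> b <= e) -> c <= e.
Proof.
move=> /= h hp hq; rewrite -[c]meetxx -le_bimp; apply: (le_trans h).
rewrite leUx !le_bimp hp ?leIl ?leIr //=.
by rewrite hq ?leIl ?leIr.
Qed.

Lemma value_or_introl c p q (r : nat -> VA) : c <= value r p ->
  c <= value r (FOr p q).
Proof. by move=> h; apply: (le_trans h); rewrite leUl. Qed.

Lemma value_or_intror c p q (r : nat -> VA) : c <= value r q ->
  c <= value r (FOr p q).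
Proof. by move=> h; apply: (le_trans h); rewrite leUr. Qed.

Lemma value_iff c p q (r : nat -> VA) : c <= value r (FIff p q) <->
  forall b, b <= c -> (b <= value r p <-> b <= value r q).
Proof.
rewrite value_and !value_imp; split=> [[h h'] b bc|h].
  by split; [apply: h|apply: h'].
by split=> b bc; apply h.
Qed.

Lemma value_in c (t s : term VA) (r : nat -> VA) : (c <= value r (FIn t s)) =
  (c <= memv (sval (eval_term r t)) (sval (eval_term r s))).
Proof. by rewrite /= value_inE //; apply: svalP. Qed.

Lemma value_eq c (t s : term VA) (r : nat -> VA) : (c <= value r (FEq t s)) =
  (c <= eqv (sval (eval_term r t)) (sval (eval_term r s))).
Proof. by rewrite /= value_eqE //; apply: svalP. Qed.

Lemma value_not c p (r : nat -> VA) : c <= value r (FNot p) <->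
  forall b, b <= c -> b <= value r p -> b <= \bot.
Proof. by rewrite -(value_imp c p FBot) /= /bimp joinx0. Qed.

(** All the variables are changed at the same time, so that the induction on [p]
  passes through the quantifiers, where reflexivity takes care of the new
  variable. *)
Lemma value_leibniz p : forall (r r' : nat -> VA) c,
  (forall n, c <= eqv (sval (r n)) (sval (r' n))) ->
  c <= value r p -> c <= value r' p.
Proof.
have symm (r r' : nat -> VA) c b :
    (forall n, c <= eqv (sval (r n)) (sval (r' n))) -> b <= c ->
    (forall n, b <= eqv (sval (r' n)) (sval (r n))).
  by move=> h bc n; apply: eqv_symm;
    [exact: svalP|exact: svalP|exact: le_trans bc (h n)].
have evalE (r r' : nat -> VA) c t :
    (forall n, c <= eqv (sval (r n)) (sval (r' n))) ->
    c <= eqv (sval (eval_term r t)) (sval (eval_term r' t)).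
  by case: t => //= v _; apply: eqv_refl; apply: svalP.
have weak (r r' : nat -> VA) c b :
    (forall n, c <= eqv (sval (r n)) (sval (r' n))) -> b <= c ->
    (forall n, b <= eqv (sval (r n)) (sval (r' n))).
  by move=> h bc n; apply: le_trans bc (h n).
have ext (r r' : nat -> VA) c (u : VA) :
    (forall n, c <= eqv (sval (r n)) (sval (r' n))) ->
    forall n, c <= eqv (sval (scons u r n)) (sval (scons u r' n)).
  by move=> h [|n] //=; apply: eqv_refl; apply: svalP.
elim: p => [|t s|t s|p IHp q IHq|p IHp q IHq|p IHp q IHq|p IHp|p IHp|p IHp]
  r r' c rr' //.
- rewrite !value_in => h; have et := evalE _ _ _ t rr'; have es :=
    evalE _ _ _ s rr'.
  apply: (mem_eql _ _ _ et); try exact: svalP.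
  by apply: (mem_eqr _ _ _ es); try exact: svalP.
- rewrite !value_eq => h; have et := evalE _ _ _ t rr'; have es :=
    evalE _ _ _ s rr'.
  apply: (eqv_trans _ _ _ _ es); try exact: svalP.
  by apply: (eqv_trans _ _ _ (eqv_symm _ _ et) h); exact: svalP.
- rewrite !value_imp => h b bc bp; apply: IHq (weak _ _ _ _ rr' bc) (h b bc _).
  by apply: IHp bp; apply: symm bc.
- by rewrite !value_and => -[hp hq]; split; [apply: IHp hp|apply: IHq hq].
- move=> h; apply: (value_or_elim h) => b bc hb.
    by apply: value_or_introl; apply: IHp hb; apply: weak bc.
  by apply: value_or_intror; apply: IHq hb; apply: weak bc.
- by rewrite !value_not => h b bc bp; apply: h => //; apply: IHp bp;
    apply: symm bc.
- move=> h; apply: (value_ex_elim h) => u b bc hb;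
    apply: (value_ex_intro (u := u)).
  by apply: IHp hb; apply: ext; apply: weak bc.
- rewrite !value_all => h u; apply: IHp (h u); exact: ext.
Qed.

(** * Constructing names *)

Lemma name_of D (g : V -> A) : defV g -> (forall x, x ∈ D -> in_VA x) ->
  exists2 w, in_VA w & forall x z, maps w x z <-> x ∈ D /\ z = code (g x).
Proof.
rewrite /defV => dg vD; have [C hC] := carrier_in hA.
have [|w [wp hw]] := @relation_set V (fun x z => z = code (g x)) D C;
  first by defauto.
have fw x z : maps w x z <-> x ∈ D /\ z = code (g x).
  by rewrite hw; split=> [[]|[xD ->]] //; split=> //; apply/hC; exists (g x).
exists w => //; apply: VA_intro; last by move=> x [z /fw[/vD]].
split; last by move=> x z /fw[_ ->]; exists (g x).
by split=> // x z z' /fw[_ ->] /fw[_ ->].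
Qed.

(** The name with domain [D] and extents [‖p‖] works: by Leibniz's law its members
  satisfy [p], and the covering hypothesis says that whatever satisfies [p] is
  equal to an element of [D], which then satisfies [p] as well. *)
Lemma comprehension p (r : nat -> VA) D : (forall x, x ∈ D -> in_VA x) ->
  (forall (z : VA) c e, c <= value (scons z r) p ->
    (forall (x : VA) b, sval x ∈ D -> b <= c -> b <= eqv (sval x) (sval z) ->
       b <= e) -> c <= e) ->
  exists w : VA, (forall x, in_dom (sval w) x <-> x ∈ D) /\
    forall (z : VA) c, c <= memv (sval z) (sval w) <-> c <= value (scons z r) p.
Proof.
move=> vD cover; have [g dg hg] := def_value1 p r.
have [w vw fw] := name_of dg vD; exists (exist _ w vw); split=> /=.
  move=> x; split=> [[z /fw[]]|xD] //; by exists (code (g x)); apply/fw.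
have subst (x z : VA) c : c <= eqv (sval x) (sval z) ->
    c <= value (scons x r) p -> c <= value (scons z r) p.
  by move=> xz; apply: value_leibniz => -[|n] //=; apply: eqv_refl;
    apply: svalP.
move=> z c; split=> [h|h].
  apply: (mem_elim h) => x a b /fw[xD /(code_inj hA)->] bc bg bxz.
  by apply: (subst (exist _ x (vD _ xD))) => //; rewrite hg.
apply: (cover _ _ _ h) => x b xD bc bxz.
have wx : maps w (sval x) (code (g (sval x))) by apply/fw.
apply: (mem_intro wx) => //; rewrite -hg; apply: (subst z);
  last exact: le_trans bc h.
by apply: eqv_symm => //; apply: svalP.
Qed.

Lemma comprehension_valid p (r : nat -> VA) D : (forall x, x ∈ D -> in_VA x) ->
  (forall (z : VA) c e, c <= value (scons z r) p ->
    (forall (x : VA) b, sval x ∈ D -> b <= c -> b <= eqv (sval x) (sval z) ->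
       b <= e) -> c <= e) ->
  forall c, c <= value r (FEx (FAll (FIff (FIn (Var 0) (Var 1)) (rename (skip 1) p)))).
Proof.
move=> vD cover c; have [w [_ hw]] := comprehension vD cover.
apply: (value_ex_intro (u := w)); apply/value_all => z; apply/value_iff => b _.
rewrite value_in value_rename.
have -> : (fun n => scons z (scons w r) (skip 1 n)) = scons z r
  by apply/funext => -[].
exact: hw.
Qed.


(** * Validity of the axioms *)

Lemma value_allin c (t : term VA) p (r : nat -> VA) :
  c <= value r (FAllIn t p) <-> forall (x : VA) b, b <= c ->
    b <= memv (sval x) (sval (eval_term r t)) -> b <= value (scons x r) p.
Proof.
have E (x : VA) : eval_term (scons x r) (rename_term succn t) = eval_term r t.
  by rewrite eval_rename_term.
rewrite /FAllIn value_all; split=> h x.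
  by move=> b bc; rewrite -(E x) => xt;
    apply: ((value_imp _ _ _ _).1 (h x)) => //; rewrite value_in.
by apply/value_imp => b bc; rewrite value_in E; apply: h.
Qed.

Lemma value_exin_intro c (x : VA) (t : term VA) p (r : nat -> VA) :
  c <= memv (sval x) (sval (eval_term r t)) -> c <= value (scons x r) p ->
  c <= value r (FExIn t p).
Proof.
move=> xt hp; apply: (value_ex_intro (u := x)); apply/value_and; split=> //.
by rewrite value_in eval_rename_term.
Qed.

Lemma value_exin_elim c e (t : term VA) p (r : nat -> VA) :
  c <= value r (FExIn t p) ->
  (forall (x : VA) b, b <= c -> b <= memv (sval x) (sval (eval_term r t)) ->
    b <= value (scons x r) p -> b <= e) -> c <= e.
Proof.
move=> h hx; apply: (value_ex_elim h) => x b bc /value_and[].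
by rewrite value_in eval_rename_term; apply: hx.
Qed.

Lemma dom_VA (u : VA) x : in_dom (sval u) x -> in_VA x.
Proof. by have [_] := VA_dom (svalP u); apply. Qed.

Lemma extensionality_valid c (r : nat ->
  VA) : c <= value r (ax_extensionality VA).
Proof.
apply/value_all => x; apply/value_all => y; apply/value_imp => b _ /value_all h.
rewrite value_eq; apply: eq_intro; try exact: svalP.
  move=> z p a xz ab ap; have vz := dom_VA (maps_dom xz).
  have /value_iff/(_ a ab) := h (exist _ z vz); rewrite !value_in => hz;
    apply hz.
  exact: (mem_dom (svalP x) xz).
move=> z p a yz ab ap; have vz := dom_VA (maps_dom yz).
have /value_iff/(_ a ab) := h (exist _ z vz); rewrite !value_in => hz; apply hz.
exact: (mem_dom (svalP y) yz).
Qed.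

Lemma pairing_valid c (r : nat -> VA) : c <= value r (ax_pairing VA).
Proof.
apply/value_all => x; apply/value_all => y.
have [D hD] := pairing_ex (sval x) (sval y).
apply: (@comprehension_valid (FOr (FEq (Var 0) (Var 2)) (FEq (Var 0) (Var 1)))
  _ D).
  by move=> z /hD[->|->]; apply: svalP.
move=> z b e h hx; apply: (value_or_elim h) => a ab; rewrite value_eq => az.
  by apply: (hx x) => //; [apply/hD; left|apply: eqv_symm az; exact: svalP].
by apply: (hx y) => //; [apply/hD; right|apply: eqv_symm az; exact: svalP].
Qed.

Lemma empty_valid c (r : nat -> VA) : c <= value r (ax_empty VA).
Proof.
have [D hD] := empty_set (code \bot).
apply: (@comprehension_valid (FImp (FEq (Var 0) (Var 0)) FBot) _ D).
  by move=> x /hD.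
move=> z b e /value_imp/(_ b (lexx b)); rewrite value_eq => h _.
by apply: le_trans (h _) (le0x _); apply: eqv_refl; apply: svalP.
Qed.

Lemma separation_valid c p (r : nat -> VA) : c <= value r (ax_separation p).
Proof.
apply/value_all => x; have [D hD] := dom_set (sval x).
apply: (@comprehension_valid (FAnd (FIn (Var 0) (Var 1)) p) _ D).
  by move=> y /hD/dom_VA.
move=> z b e /value_and[]; rewrite value_in => zx _ hx.
apply: (mem_elim zx) => y a a' xy a'b _ a'z; have vy := dom_VA (maps_dom xy).
by apply: (hx (exist _ y vy)) => //; apply/hD; apply: maps_dom xy.
Qed.

(** Members of members of [x] are covered by the domains of the elements of the
  domain of [x]. *)
Lemma union_valid c (r : nat -> VA) : c <= value r (ax_union VA).
Proof.
apply/value_all => x; have [D hD] := dom_set (sval x).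
have [||E hE] := @collection V (fun y F => forall z, z ∈ F <-> in_dom y z) D.
- by defauto.
- by move=> y _; apply: dom_set.
have [U hU] := union_ex E; have [|W hW] := @separation V in_VA U; first
  by defauto.
apply: (@comprehension_valid (FExIn (Var 1) (FIn (Var 1) (Var 0))) _ W).
  by move=> z /hW[].
move=> z b e h hz; apply: (value_exin_elim h) => y a ab yx;
  rewrite value_in => zy.
apply: (mem_elim yx) => y' p' a' xy' a'a _ a'y'y.
have vy' := dom_VA (maps_dom xy').
have a'zy' : a' <= memv (sval z) y'.
  apply: (mem_eqr (svalP y) vy' (svalP z)); last exact: le_trans a'a zy.
  by apply: eqv_symm a'y'y => //; apply: svalP.
apply: (mem_elim a'zy') => z' q a'' yz' a''a' _ a''z.
have [_ /(_ _ (maps_dom yz')) vz'] := VA_dom vy'.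
apply: (hz (exist _ z' vz')) => //.
  apply/hW; split=> //; have [|F FE hF] := hE y'; first by apply/hD;
    exact: maps_dom xy'.
  by apply/hU; exists F => //; apply/hF; exact: maps_dom yz'.
exact: le_trans a''a' (le_trans a'a ab).
Qed.

(** A subset [z] of [x] is equal to the name [z'] with the same domain as [x] and
  with extents [‖y ∈ z‖]; such names are subsets of [dom x * A]. *)
Lemma powerset_valid c (r : nat -> VA) : c <= value r (ax_powerset VA).
Proof.
apply/value_all => x; have [D hD] := dom_set (sval x).
have [C hC] := carrier_in hA.
have [|F [Fp hF]] := @relation_set V (fun _ _ => True) D C;
  first exact: def_prop.
have [Q hQ] := powerset_ex F; have [|W hW] := @separation V in_VA Q;
  first by defauto.
apply: (@comprehension_valid (FAllIn (Var 0) (FIn (Var 0) (Var 2))) _ W).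
  by move=> z /hW[].
move=> z b e h hz.
have dg : defV (fun y => memv y (sval z)) by rewrite /defV; defauto.
have [|z' vz' fz'] := @name_of D _ dg; first by move=> y /hD/dom_VA.
have bz (y : VA) a : a <= b -> a <= memv (sval y) (sval z) ->
    a <= memv (sval y) (sval x).
  move=> ab yz; have /value_allin /(_ y a ab yz) := h.
  by rewrite value_in.
apply: (hz (exist _ z' vz')) => //=.
  apply/hW; split=> //; apply/hQ => p pz'.
  have [[[/(_ _ pz')[y [a hp]] _] _] _] := VA_dom vz'.
  have /fz'[yD ea] : maps z' y a by exists p.
  have [|q hq qF] := (hF y a).2; last by rewrite (opair_uniq hp hq).
  by split=> //; apply/hC; rewrite ea; eexists.
apply: eq_intro => //; first exact: svalP.
  by move=> y p a /fz'[_ /(code_inj hA)->].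
move=> y p a zy ab ap; have vy := dom_VA (maps_dom zy).
have ayz : a <= memv y (sval z) by exact: (mem_dom (svalP z) zy).
have ayx := bz (exist _ y vy) a ab ayz.
apply: (mem_elim ayx) => t q a' xt a'a _ a'ty.
have vt := dom_VA (maps_dom xt).
have zt : maps z' t (code (memv t (sval z))).
  by apply/fz'; split=> //; apply/hD; exact: maps_dom xt.
apply: (mem_intro zt) => //.
apply: (mem_eql vy vt (svalP z)); last exact: le_trans a'a ayz.
exact: eqv_symm.
Qed.

(** The name [z] witnessing [p(y, z)] depends on the condition.  To choose from a
  set, it suffices to have one witness for each pair of an element [y] of the
  domain of [x] and a truth value that [p(y, _)] takes: Collection in the model
  provides them. *)
Lemma collection_valid c p (r : nat -> VA) : c <= value r (ax_collection p).
Proof.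
apply/value_all => x; apply/value_imp => b _ h.
have [C hC] := carrier_in hA; have [D hD] := dom_set (sval x).
have [g dg hg] := def_value2 p (scons x r).
have [|F [Fp hF]] := @relation_set V (fun _ _ => True) D C;
  first exact: def_prop.
have [||W hW] := @collection V (fun s z => forall y a, is_opair s y (code a) ->
    (exists2 z', in_VA z' & g z' y = a) -> in_VA z /\ g z y = a) F.
- by defauto.
- move=> q _; case: (pselect (exists y a z', 
    [/\ is_opair q y (code a), in_VA z' & g z' y = a])) => [|nq].
    move=> [y [a [z [hq vz gz]]]]; exists z => y' a' hq' _.
    by have [<- /(code_inj hA)<-] := opair_inj hq hq'.
  exists (sval x) => y a hq [z vz gz]; case: nq; by exists y, a, z.
have [|W' hW'] := @separation V in_VA W; first by defauto.
have [|w vw fw] := @name_of W' (fun=> \top) (dfun_cst (code \top)).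
  by move=> z /hW'[].
apply: (value_ex_intro (u := exist _ w vw)).
apply/value_allin => y a ab ayx.
apply: (mem_elim ayx) => y' p' a' xy' a'a _ a'y'y; have vy' :=
  dom_VA (maps_dom xy').
have h' := (value_allin _ _ _ _).1 h (exist _ y' vy') a' (le_trans a'a ab).
apply: (value_ex_elim (h' _)).
  apply: (mem_eql (svalP y) vy' (svalP x)); last exact: le_trans a'a ayx.
  by apply: eqv_symm a'y'y => //; apply: svalP.
move=> z a'' a''a'; rewrite hg => a''z.
have [q hq qF] : maps F y' (code (g (sval z) y')).
  by apply/hF; split=> //; [apply/hD; exact: maps_dom xy'|apply/hC; eexists].
have [z0 z0W /(_ _ _ hq)[]] := hW q qF; first by exists (sval z) => //;
  apply: svalP.
move=> vz0 gz0.
have wz0 : maps w z0 (code \top) by apply/fw; split=> //; apply/hW'.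
apply: (value_exin_intro (x := exist _ z0 vz0)).
  by apply: (mem_dom vw wz0); apply: lex1.
rewrite value_rename.
apply: (@value_leibniz p (scons (exist _ z0 vz0 : VA)
    (scons (exist _ y' vy' : VA) (scons x r)))).
  move=> [|[|n]] /=; first exact: (eqv_refl _ vz0).
    exact: le_trans a''a' a'y'y.
  by apply: eqv_refl; case: n => [|n]; exact: svalP.
by rewrite hg /= gz0.
Qed.

Lemma induction_valid c p (r : nat -> VA) : c <= value r (ax_induction p).
Proof.
apply/value_imp => b _ /value_all h; apply/value_all.
have [g dg hg] := def_value1 p r; rewrite /defV in dg.
suff hx x : in_VA x -> b <= g x by move=> u; rewrite hg; apply: hx;
  apply: svalP.
move: x; apply: VA_ind; first by apply: def_le; [apply: dfun_cst|defauto].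
move=> x vx IH; have /value_imp := h (exist _ x vx); rewrite hg; apply=> //.
apply/value_allin => y a ab yx; apply: (mem_elim yx) => /= z q a' xz a'a _ a'zy.
rewrite value_rename.
have vz : in_VA z by have [_] := VA_dom vx; apply; exact: maps_dom xz.
apply: (@value_leibniz p (scons (exist _ z vz : VA) r)).
  by move=> [|n] //=; apply: eqv_refl; exact: svalP.
by rewrite hg; apply: le_trans (le_trans a'a ab) (IH _ (maps_dom xz)).
Qed.


Lemma in_stage_mono (xi xi' : V) x : is_ordinal xi -> is_ordinal xi' ->
  (forall z, z ∈ xi -> z ∈ xi') -> in_stage xi x -> in_stage xi' x.
Proof.
move=> oxi oxi' sub /(in_stageE _ oxi)[nx [z zx hz]].
by apply/(in_stageE _ oxi'); split=> //; exists z => //; apply: sub.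
Qed.

(** The union of the ordinals of an inductive set.  Every [k] below it is included
  in an ordinal [n] whose successor is also below it, from which it follows that
  its stage is closed under successors. *)
Lemma limit_ordinal : exists al : V, [/\ is_ordinal al, exists k, k ∈ al &
  forall k, k ∈ al -> exists n m, [/\ is_ordinal n, forall z, z ∈ k -> z ∈ n,
    m ∈ al & forall z, z ∈ m <-> z ∈ n \/ z = n]].
Proof.
have [I [[e he eI] hI]] := infinity (code \bot).
have [|J hJ] := @separation V (@is_ordinal V) I; first by defauto.
have succJ y : y ∈ J -> exists2 s, (forall z, z ∈ s <-> z ∈ y \/ z = y) & s ∈ J.
  by move=> /hJ[/hI[s hs sI] oy]; exists s => //; apply/hJ; split=> //;
    apply: ordinal_succ hs.
have eJ : e ∈ J by apply/hJ; split=> //; split=> [y z|y] /he.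
have [al hal] := union_ex J; exists al; split.
- by apply: ordinal_union hal => x /hJ[].
- have [s hs sJ] := succJ _ eJ; exists e; apply/hal; exists s => //.
  by apply/hs; right.
move=> k /hal[n nJ kn]; have [m hm mJ] := succJ _ nJ.
have [m' hm' m'J] := succJ _ mJ; have [_ on] := (hJ n).1 nJ.
exists n, m; split=> //; last by apply/hal; exists m' => //; apply/hm'; right.
by move=> z zk; have [tr _] := on; apply: tr kn zk.
Qed.

(** All the names of the stage [S] at a limit ordinal, with extent 1.  [S] contains
  the empty name, and with each [x] a name [s] for its successor, obtained by
  [comprehension] with domain [dom x] extended by [x]. *)
Lemma infinity_valid c (r : nat -> VA) : c <= value r (ax_infinity VA).
Proof.
have [al [oal [k0 k0al] hal]] := limit_ordinal; have [S hS] := stage_ex oal.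
have vS x : x ∈ S -> in_VA x by move/(in_stageP _ hS); exists al.
have [|w vw fw] := @name_of S (fun=> \top) (dfun_cst (code \top));
  first exact: vS.
have wS x : x ∈ S -> c <= memv x w.
  by move=> xS; apply: (mem_dom vw) (lex1 _); apply/fw.
apply: (value_ex_intro (u := exist _ w vw)); apply/value_and; split.
  have [e he] := empty_set (code \bot).
  have ne x z : ~ maps e x z by move=> [p _ /he].
  have ve : in_VA e.
    apply: VA_intro; last by move=> x [z /ne].
    by split=> [|x z /ne] //; split=> [p /he|x z z' /ne].
  have eS : e ∈ S.
    apply/(in_stageP _ hS)/(in_stageE _ oal); have [ne' _] := VA_dom ve.
    by split=> //; exists k0 => // y [z /ne].
  apply: (value_ex_intro (u := exist _ e ve)); apply/value_and; split;
    last first.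
    by rewrite value_in; apply: wS.
  apply/value_all => z; apply/value_iff => b _; rewrite value_in; split=> [h|].
    by apply: (mem_elim h) => x p a /ne.
  move/value_imp/(_ b (lexx b)); rewrite value_eq => h.
  by apply: le_trans (h _) (le0x _); apply: eqv_refl; apply: svalP.
apply/value_allin => y b bc yw.
apply: (mem_elim yw) => x p a /fw[xS _] ab _ axy; have vx := vS _ xS.
have [nx [k kal dxk]] := (in_stageE _ oal).1 ((in_stageP _ hS).2 xS).
have [n [m [on kn mal hm]]] := hal _ kal.
have dxn z : in_dom x z -> in_stage n z.
  by move=> /dxk; apply: in_stage_mono => //; apply: ordinal_elt kal.
have om := ordinal_elt oal mal.
have [X hX] := dom_set x; have [D hD] := add_element X x.
have [] := @comprehension (FOr (FIn (Var 0) (Var 1)) (FEq (Var 0) (Var 1)))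
    (scons (exist _ x vx : VA) r) D.
- move=> z /hD[/hX|-> //]; have [_] := VA_dom vx; exact.
- move=> z e e' h hz; apply: (value_or_elim h) => f fe.
    rewrite value_in => /= zx; apply: (mem_elim zx) => t q f' xt f'f _ f'tz.
    have vt : in_VA t by have [_] := VA_dom vx; apply; exact: maps_dom xt.
    apply: (hz (exist _ t vt)) => //; last exact: le_trans f'f fe.
    by apply/hD; left; apply/hX; exact: maps_dom xt.
  rewrite value_eq => /= zx; apply: (hz (exist _ x vx)) => //.
    by apply/hD; right.
  by apply: eqv_symm zx => //; apply: svalP.
move=> s [ds hs].
have sS : sval s ∈ S.
  apply/(in_stageP _ hS)/(in_stageE _ oal); have [ns _] := VA_dom (svalP s).
  split=> //; exists m => // z /ds/hD[/hX xz|->].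
    by apply: (in_stage_mono on om) (dxn _ xz) => t tn; apply/hm; left.
  by apply/(in_stageE _ om); split=> //; exists n => //; apply/hm; right.
apply: (value_ex_intro (u := s)); apply/value_and; split; last first.
  by rewrite value_in; apply: le_trans (le_trans ab bc) (wS _ sS).
apply: (@value_leibniz (succ_formula VA) (scons s (scons (exist _ x vx : VA)
    (scons (exist _ w vw : VA) r)))).
  by move=> [|[|n']] //=; apply: eqv_refl; exact: svalP.
apply/value_all => z; apply/value_iff => a' _; rewrite value_in.
exact: hs.
Qed.

Lemma set_axiom_valid phi : set_axiom phi -> @valid V d A code phi.
Proof.
move=> h r; apply/eqP; rewrite -le1x; case: h.
- exact: extensionality_valid.
- exact: pairing_valid.
- by move=> p; exact: collection_valid.
- exact: powerset_valid.
- by move=> p; exact: separation_valid.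
- exact: empty_valid.
- exact: union_valid.
- exact: infinity_valid.
- by move=> p; exact: induction_valid.
Qed.

End Algebra.

Theorem corollary5p12 (V : set_model) (d : Order.disp_t)
    (A : ctbDistrLatticeType d) (code : A -> V) (hA : complete_in code) :
  (forall phi : formula (VA code), ZF_Comega_axiom phi -> valid phi) /\
  (forall phi : formula (VA code), ZF_C2omega_axiom phi -> valid phi).
Proof. by split=> phi; apply: set_axiom_valid. Qed.
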